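(* Let $q\geq1$ be real and let $p_c(q)$ be the critical point of the random-cluster model with cluster-weight $q$ on the square lattice $\mathbb{Z}^2$. For any $p<p_c(q)$, there exist constants $0<C(p,q),c(p,q)<\infty$ such that for any $x,y\in\mathbb{Z}^2$, $$\phi_{p,q}(x\leftrightarrow y)\leq C(p,q)\,e^{-c(p,q)|x-y|},$$ where $|\cdot|$ denotes the Euclidean norm.
   Context: Random-cluster model. Let $G$ be a finite subgraph of the square lattice (nearest-neighbour edges), with boundary $\partial G$ = the set of sites of $G$ joined by a lattice edge to a site outside $G$. A configuration $\omega$ declares each edge of $G$ open or closed. A boundary condition $\xi$ is a partition of $\partial G$; sites in the same block are identified (wired). For $p\in[0,1]$, $q>0$, $$\phi^{\xi}_{p,q,G}(\{\omega\})=\frac{p^{o(\omega)}(1-p)^{c(\omega)}q^{k(\omega,\xi)}}{Z^\xi_{p,q,G}},$$ where $o(\omega)$, $c(\omega)$ are the numbers of open and closed edges, $k(\omega,\xi)$ is the number of connected components of the graph of open edges (including isolated sites) after wiring by $\xi$, and $Z^\xi_{p,q,G}$ is the normalizing constant. Free boundary condition ($\xi=0$): all blocks are singletons. Wired boundary condition ($\xi=1$): a single block. For $q\ge1$, the infinite-volume measures $\phi^0_{p,q}$ and $\phi^1_{p,q}$ are the weak limits of $\phi^0_{p,q,G}$ and $\phi^1_{p,q,G}$ along boxes $G$ increasing to the whole lattice (these limits exist). More generally, infinite-volume measures are those obtained as limits with arbitrary boundary conditions; all of them lie stochastically between $\phi^0_{p,q}$ and $\phi^1_{p,q}$. The critical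 point $p_c(q)$ is the value such that, for every infinite-volume measure with parameters $(p,q)$, there is almost surely no infinite open cluster if $p<p_c(q)$ and almost surely at least one if $p>p_c(q)$. For $p<p_c(q)$ the infinite-volume measure is unique (a known fact) and is denoted by $\phi_{p,q}$. $x\leftrightarrow y$ is the event that $x$ and $y$ are joined by a path of open edges. *)

(* Defs.v *)
From HB Require Import structures.
From mathcomp Require Export all_boot all_order all_algebra finmap.
From mathcomp Require Export all_classical all_reals all_analysis.
Export Order.TTheory GRing.Theory Num.Theory numFieldNormedType.Exports.

Set Implicit Arguments.
Unset Strict Implicit.
Unset Printing Implicit Defensive.

Local Open Scope fset_scope.
Local Open Scope classical_set_scope.
Local Open Scope ring_scope.

Definition site : Type := (int * int)%type.
HB.instance Definition _ := Countable.on site.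

Definition east (x : site) : site := (x.1 + 1, x.2).
Definition west (x : site) : site := (x.1 - 1, x.2).
Definition north (x : site) : site := (x.1, x.2 + 1).
Definition south (x : site) : site := (x.1, x.2 - 1).

Definition lattice_nbrs (x : site) : seq site :=
  [:: east x; west x; north x; south x].

(* Each unordered nearest-neighbour pair is represented exactly once, by its
   west or south endpoint and a direction: (x, false) is {x, east x} and
   (x, true) is {x, north x}. *)
Definition edge : Type := (site * bool)%type.
HB.instance Definition _ := Countable.on edge.

Definition head_of (e : edge) : site := if e.2 then north e.1 else east e.1.

(* A finite subgraph need not be induced; its sites may be isolated. *)
Record subgraph := Subgraph {
  sites : {fset site};
  edges : {fset edge};
  edges_sites : forall e, e \in edges -> (e.1 \in sites) && (head_of e \in sites)
}.

(* true means open *)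
Definition config : Type := {ptws edge -> bool}.
HB.instance Definition _ := Topological.on config.
HB.instance Definition _ := Pointed.on config.

Definition open_adj (w : config) (x y : site) : bool :=
  [|| w (x, false) && (y == east x),  w (x, true) && (y == north x),
      w (y, false) && (x == east y) | w (y, true) && (x == north y)].

Definition joined (w : config) (x y : site) : Prop :=
  exists s : seq site, path (open_adj w) x s /\ last x s = y.

Definition has_infinite_cluster (w : config) : Prop :=
  exists x : site, infinite_set [set y | joined w x y].

Section FiniteVolume.
Context {R : realType}.
Variables (p q : R) (G : subgraph).

Definition boundary : {set sites G} :=
  [set v : sites G | has [pred y | y \notin sites G] (lattice_nbrs (val v))]%SET.

Definition fconfig : finType := {ffun edges G -> bool}.

Definition closed_extension (w : fconfig) : config :=
  fun e => if insub e is Some e' then w e' else false.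

Variable xi : {set {set sites G}}.

Definition wired_adj (w : fconfig) : rel (sites G) :=
  fun u v => open_adj (closed_extension w) (val u) (val v)
             || [exists B in xi, (u \in B) && (v \in B)].

Definition num_open (w : fconfig) : nat := #|[pred e | w e]|.
Definition num_closed (w : fconfig) : nat := #|[pred e | ~~ w e]|.
(* wired_adj is symmetric, so n_comp counts connected components. *)
Definition num_clusters (w : fconfig) : nat := n_comp (wired_adj w) predT.

Definition rc_weight (w : fconfig) : R :=
  p ^+ num_open w * (1 - p) ^+ num_closed w * q ^+ num_clusters w.

Definition rc_partition_function : R := \sum_(w : fconfig) rc_weight w.

Definition rc_prob (w : fconfig) : R := rc_weight w / rc_partition_function.

(* The choice of extension outside G does not affect weak limits along
   subgraphs exhausting the lattice. *)
Definition rc_expectation (f : config -> R) : R :=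
  \sum_(w : fconfig) rc_prob w * f (closed_extension w).

End FiniteVolume.

(* The Borel sigma-algebra; edge being countable, it is also the one generated
   by the cylinder events. *)
Definition config_borel := g_sigma_algebraType (open : set (set config)).

Definition is_box (G : subgraph) : Prop :=
  exists a b : site,
    (forall x : site, (x \in sites G) =
       ((a.1 <= x.1 <= b.1) && (a.2 <= x.2 <= b.2))) /\
    (forall e : edge, (e \in edges G) =
       ((e.1 \in sites G) && (head_of e \in sites G))).

Definition boxes_to_lattice (G : nat -> subgraph) : Prop :=
  [/\ forall n, is_box (G n),
      forall n, (sites (G n) `<=` sites (G n.+1))%fset
    & forall x : site, exists n, x \in sites (G n)].

(* A weak limit along some increasing sequence of boxes, with arbitrary boundary
   conditions. *)
Definition infinite_volume (R : realType) (p q : R)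
    (phi : probability config_borel R) : Prop :=
  exists (G : nat -> subgraph) (xi : forall n, {set {set sites (G n)}}),
    [/\ boxes_to_lattice G,
        forall n, finset.partition (xi n) (boundary (G n))
      & forall f : config -> R, continuous f ->
          (rc_expectation p q (xi n) f)%:E @[n --> \oo] --> 'E_phi[f]%E].

(* A relation rather than a function: pc is the value determined by the
   dichotomy, whose existence is not built into the definition. *)
Definition is_critical_point (R : realType) (q pc : R) : Prop :=
  [/\ 0 <= pc <= 1,
      forall (p : R) (phi : probability config_borel R),
        0 <= p <= 1 -> infinite_volume p q phi -> p < pc ->
        {ae phi, forall w, ~ has_infinite_cluster w}
    & forall (p : R) (phi : probability config_borel R),
        0 <= p <= 1 -> infinite_volume p q phi -> pc < p ->
        {ae phi, forall w, has_infinite_cluster w}].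

Definition euclid_dist (R : realType) (x y : site) : R :=
  Num.sqrt (((x.1 - y.1)%:~R) ^+ 2 + ((x.2 - y.2)%:~R) ^+ 2).

(* Main.v *)
(** Fix p < p2 < pc.  A wired infinite-volume measure at p2 exists and has no infinite
    cluster, so in large wired boxes at p2 every cluster is unlikely to leave a ball of
    fixed radius around its base point, uniformly in the base point.

    Let m(C) be the number of levels j < n such that C has a site at sup-distance j from
    the origin, and tilt the wired box measure at p2 by g(C_0) = c^m(C_0), with c < 1 so
    close to 1 that E[g(C_y)] >= 1 - eps for every site y.  Explore the cluster of the origin
    edge by edge: opening an edge to a new site y multiplies the expected tilt by at least
    E[g(C_y)] >= 1 - eps, so the tilt lowers the odds of each edge by at most this factor.
    Therefore the tilted cluster of the origin at p2 still dominates the one at p as soon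
    as p (1 - p2) <= (1 - eps) p2 (1 - p).  Consequently, at p the probability to reach distance n
    is at most the tilted one at p2, that is at most c^n / (1 - eps).

    This is the stochastic comparison method of Vanneuville for Bernoulli percolation,
    adapted to the random-cluster model through the monotonicity in boundary
    conditions. *)

From HB Require Import structures.
Require Import Defs.
From mathcomp Require Import ring lra zify.

Set Implicit Arguments.
Unset Strict Implicit.
Unset Printing Implicit Defensive.

Local Open Scope ring_scope.

(** * Independent edges, and reweightings of them *)

(** A tilt by a function of the cluster of the origin need not preserve positive association, so no
    lattice condition compares the tilted measure with the one at p. Only the laws of the cluster
    are compared, edge by edge, and at each edge positive association is used on the untilted side
    alone. The number of levels is a suitable exponent because it is increasing and subadditive
    under unions, so [g] is decreasing with [g X * g Y <= g (X :|: Y)]. Moreover a cluster inside a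
    ball of radius r meets at most 2r+1 levels, so c can be fixed before n. The bound E[g(C_y)] >= 1
    - eps must also hold for sites near the wired boundary, whose clusters may be huge. Such a
    cluster lowers [g] only by coming back near the origin. A union bound over the box of radius n
    excludes this, and is affordable because the size of the surrounding wired box may depend on n.
    Wired boxes dominate every boundary condition on every larger domain, so one finite-volume
    estimate serves all base points and all infinite-volume measures. *)

Section Bernoulli.
Import mathcomp.boot.fintype mathcomp.boot.finset.
Variables (R : realFieldType) (E : finType).
Implicit Types (a : E -> R) (A B : {set E}) (F G w f : {set E} -> R) (e : E).

Definition bern_weight a A : R := \prod_e (if e \in A then a e else 1 - a e).

Definition bern a F : R := \sum_(A : {set E}) bern_weight a A * F A.

Definition update a e (x : R) : E -> R := fun e' => if e' == e then x else a e'.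

Definition params a := forall e, 0 <= a e <= 1.

(** Parameters 0 and 1 act as conditioning. Incompatible sets have weight zero, so pointwise
    hypotheses are only asked on supported sets. *)
Definition supported a A := forall e, (a e = 1 -> e \in A) /\ (a e = 0 -> e \notin A).

Lemma update_id a e x : update a e x e = x.
Proof. by rewrite /update eqxx. Qed.

Lemma update_params a e x : params a -> 0 <= x <= 1 -> params (update a e x).
Proof. by move=> ha hx e'; rewrite /update; case: eqP. Qed.

Lemma bern_weight_ge0 a A : params a -> 0 <= bern_weight a A.
Proof.
by move=> ha; apply: prodr_ge0 => e _; have := ha e; case: ifP => _ /andP[]; rewrite ?subr_ge0.
Qed.

Lemma bern_weight_eq0 a A : ~ supported a A -> bern_weight a A = 0.
Proof.
move=> /existsNP[e /not_andP[]/not_implyP[ae eA]]; rewrite /bern_weight (bigD1 e) //=.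
  by case: ifP eA => // _ _; rewrite ae subrr mul0r.
by case: ifP eA => [_ _|//]; rewrite ae mul0r.
Qed.

Lemma bernD a F G : bern a (fun A => F A + G A) = bern a F + bern a G.
Proof. by rewrite /bern -big_split; apply: eq_bigr => A _; rewrite mulrDr. Qed.

Lemma bernZ a c F : bern a (fun A => c * F A) = c * bern a F.
Proof. by rewrite /bern big_distrr; apply: eq_bigr => A _; rewrite mulrCA. Qed.

Lemma bern_sum (I : finType) a (F : I -> {set E} -> R) :
  bern a (fun A => \sum_i F i A) = \sum_i bern a (F i).
Proof.
by rewrite /bern exchange_big; apply: eq_bigr => A _; rewrite big_distrr.
Qed.

Lemma eq_bern a F G : (forall A, supported a A -> F A = G A) -> bern a F = bern a G.
Proof.
move=> FG; apply: eq_bigr => A _.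
have [/FG->//|/bern_weight_eq0->] := pselect (supported a A).
by rewrite !mul0r.
Qed.

Lemma ler_bern a F G : params a -> (forall A, supported a A -> F A <= G A) ->
  bern a F <= bern a G.
Proof.
move=> ha FG; apply: ler_sum => A _.
have [/FG FGA|/bern_weight_eq0->] := pselect (supported a A); last by rewrite !mul0r.
by rewrite ler_wpM2l ?bern_weight_ge0.
Qed.

Lemma bern_cst a c : bern a (fun=> c) = c.
Proof.
rewrite /bern -big_distrl /= -[RHS]mul1r; congr (_ * _).
transitivity (\prod_e (a e + (1 - a e))); first by rewrite bigA_distr.
by rewrite big1 // => e _; rewrite addrCA subrr addr0.
Qed.

Lemma bern_ge0 a F : params a -> (forall A, 0 <= F A) -> 0 <= bern a F.
Proof.
by move=> ha F0; rewrite -(bern_cst a 0); apply: ler_bern => // A _.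
Qed.

Lemma bern_gt0 a F : params a -> (forall A, 0 < F A) -> 0 < bern a F.
Proof.
move=> ha F0; have [A0 mA0] : {A0 | forall A, F A0 <= F A}.
  by exists [arg min_(A < set0) F A]%O => A; case: arg_minP => // B _ /(_ A isT).
apply: lt_le_trans (F0 A0) _; rewrite -{1}(bern_cst a (F A0)).
exact: ler_bern.
Qed.

Lemma bern_split a e F :
  bern a F = a e * bern (update a e 1) F + (1 - a e) * bern (update a e 0) F.
Proof.
rewrite /bern !big_distrr -big_split; apply: eq_bigr => A _ /=.
rewrite /bern_weight !(bigD1 (P := xpredT) e) //= !update_id.
have eqp x : \prod_(i | i != e) (if i \in A then update a e x i else 1 - update a e x i)
   = \prod_(i | i != e) (if i \in A then a i else 1 - a i).
  by apply: eq_bigr => i /negbTE ie; rewrite /update ie.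
rewrite !eqp; case: ifP => _; rewrite ?subrr ?subr0; ring.
Qed.

(** Adding [e] is a bijection from the sets without [e] to the sets with [e], and it leaves the
    factors of the other edges unchanged. *)
Lemma bern_open a e F :
  bern (update a e 1) F = bern (update a e 0) (fun A => F (e |: A)).
Proof.
rewrite /bern (bigID (fun A => e \in A)) /= [X in _ + X]big1 ?addr0; last first.
  move=> A /negbTE eA; rewrite /bern_weight (bigD1 e) //= eA update_id subrr.
  by rewrite !mul0r.
rewrite [RHS](bigID (fun A => e \notin A)) /= [X in _ = _ + X]big1 ?addr0; last first.
  move=> A; rewrite negbK => eA; rewrite /bern_weight (bigD1 e) //= eA update_id.
  by rewrite !mul0r.
rewrite (reindex_onto (fun A => e |: A) (fun A => A :\ e)) /=; last first.
  by move=> A eA; rewrite setD1K.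
have eqn (A : {set E}) : (e \notin A) = (e \in e |: A) && ((e |: A) :\ e == A).
  rewrite setU11; apply/idP/eqP => [/setU1K//|<-]; by rewrite setD11.
apply: eq_big => [A|A eA]; first by rewrite eqn.
have {}eA : e \notin A by rewrite eqn.
congr (_ * _); rewrite /bern_weight !(bigD1 (P := xpredT) e) //=.
rewrite !update_id setU11 (negbTE eA) subr0.
congr (_ * _); apply: eq_bigr => i ie; rewrite !inE (negbTE ie) /=.
by rewrite /update (negbTE ie).
Qed.

(* Edge parameters 0 and 1 encode conditioning on the edge being closed or open. *)
Definition expect w a f := bern a (fun A => w A * f A) / bern a w.

(* The two weights may come from graphs with different vertex sets or wirings: only the
   ratio by which opening an edge changes them matters. *)
Definition dominated w1 w2 := forall A B e, A \subset B -> e \notin B ->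
  w1 (e |: A) * w2 B <= w2 (e |: B) * w1 A.

Definition increasing f := forall A B, A \subset B -> f A <= f B.

(** Both sides average over the state of one edge, with odds [s * X / (1 - s)] and
    [s' * X' / (1 - s')]; these are compared in cross-multiplied form to allow parameters equal to
    1. Raising the odds needs [x0 <= x1], and no such relation between [y0] and [y1]. *)
Lemma mix_le (s s' X X' x0 x1 y0 y1 : R) : 0 <= s <= 1 -> 0 <= s' <= 1 ->
  0 < X -> 0 < X' -> s * X * (1 - s') <= s' * X' * (1 - s) ->
  x0 <= y0 -> x1 <= y1 -> x0 <= x1 ->
  (s * X * x1 + (1 - s) * x0) / (s * X + (1 - s))
    <= (s' * X' * y1 + (1 - s') * y0) / (s' * X' + (1 - s')).
Proof.
move=> /andP[s0 s1] /andP[s'0 s'1] X0 X'0 odds xy0 xy1 x01.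
have pos (t Y : R) : 0 <= t -> t <= 1 -> 0 < Y -> 0 < t * Y + (1 - t).
  move=> t0 t1 Y0; have := mulr_ge0 t0 (ltW Y0).
  case: (ltrP t 1) => [|t1']; first lra.
  have -> : t = 1 by apply/le_anti; rewrite t1 t1'.
  lra.
have D := pos s X s0 s1 X0; have D' := pos s' X' s'0 s'1 X'0.
apply: (@le_trans _ _ ((s' * X' * x1 + (1 - s') * x0) / (s' * X' + (1 - s')))).
  rewrite ler_pdivrMr // [leRHS]mulrAC ler_pdivlMr //.
  have : 0 <= (x1 - x0) * (s' * X' * (1 - s) - s * X * (1 - s')).
    by rewrite mulr_ge0 // subr_ge0.
  lra.
rewrite ler_pM2r ?invr_gt0 // lerD // ler_wpM2l //; last lra.
by rewrite mulr_ge0 // ltW.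
Qed.

Lemma expect_split w a e f : params a -> (forall A, 0 < w A) ->
  let X := bern (update a e 1) w / bern (update a e 0) w in
  expect w a f = (a e * X * expect w (update a e 1) f + (1 - a e) * expect w (update a e 0) f)
    / (a e * X + (1 - a e)).
Proof.
move=> ha w0 X.
have Z0 : 0 < bern (update a e 0) w by apply: bern_gt0 => //; apply: update_params => //; lra.
have Z1 : 0 < bern (update a e 1) w by apply: bern_gt0 => //; apply: update_params => //; lra.
have Z : 0 < bern a w by apply: bern_gt0.
rewrite /X /expect (bern_split a e w) (bern_split a e (fun A => w A * f A)).
rewrite (bern_split a e w) in Z.
set z := _ + _ in Z *; set z0 := bern _ w in Z0 *; set z1 := bern _ w in Z1 *.
have -> : a e * (z1 / z0) + (1 - a e) = z / z0.
  by rewrite /z -/z0 -/z1; field; rewrite gt_eqF.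
by field; rewrite !gt_eqF.
Qed.

Lemma ler_expect w a f g : params a -> (forall A, 0 < w A) ->
  (forall A, supported a A -> f A <= g A) -> expect w a f <= expect w a g.
Proof.
move=> ha w0 fg; rewrite ler_pM2r ?invr_gt0 ?bern_gt0 //.
by apply: ler_bern => // A /fg; rewrite ler_pM2l.
Qed.

Lemma eq_expect w a f g : (forall A, supported a A -> f A = g A) -> expect w a f = expect w a g.
Proof. by move=> fg; congr (_ / _); apply: eq_bern => A /fg->. Qed.

Lemma expect_cst w a c : params a -> (forall A, 0 < w A) -> expect w a (fun=> c) = c.
Proof.
move=> ha w0; rewrite /expect; under [X in bern a X]funext do rewrite mulrC.
by rewrite bernZ mulfK // gt_eqF // bern_gt0.
Qed.

Lemma expectD w a f g : expect w a (fun A => f A + g A) = expect w a f + expect w a g.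
Proof.
rewrite /expect -mulrDl -bernD; congr (_ / _); apply: eq_bern => A _; exact: mulrDr.
Qed.

Lemma expectZ w a c f : expect w a (fun A => c * f A) = c * expect w a f.
Proof.
rewrite /expect mulrA -bernZ; congr (_ / _); apply: eq_bern => A _; exact: mulrCA.
Qed.

Definition determined a e := (a e == 0) || (a e == 1).

Lemma expect_determined w a f : params a -> (forall A, 0 < w A) ->
  (forall e, determined a e) -> expect w a f = f [set e | a e == 1].
Proof.
move=> ha w0 da; rewrite -[RHS](expect_cst _ ha w0); apply: eq_expect => A sA.
congr f; apply/setP => e; rewrite inE; have [s1 s0] := sA e.
case/orP: (da e) => /eqP ae; rewrite ae.
  by rewrite eq_sym oner_eq0; apply/negbTE/s0.
by rewrite eqxx s1.
Qed.

(** On the support [A :\ e] is [A]. Written this way the ratio is increasing on all sets as soon as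
    [dominated w w] holds, so [expect_mono] can be applied to it. *)
Lemma expect_odds w a e : params a -> (forall A, 0 < w A) ->
  bern (update a e 1) w / bern (update a e 0) w =
  expect w (update a e 0) (fun A => w (e |: A) / w (A :\ e)).
Proof.
move=> ha w0; rewrite bern_open /expect; congr (_ / _); apply: eq_bern => A sA.
have eA : e \notin A by apply: (sA e).2; rewrite update_id.
rewrite (_ : A :\ e = A); first by rewrite mulrCA mulfV ?mulr1 // gt_eqF.
by apply/setDidPl; rewrite disjoint_sym disjoints1.
Qed.

(* Induction on the undetermined edges: conditionally on one edge the induction hypothesis
   applies, and its odds of being open are themselves increasing expectations. *)
Lemma expect_mono w1 w2 a1 a2 f : (forall A, 0 < w1 A) -> (forall A, 0 < w2 A) ->
  dominated w1 w1 -> dominated w1 w2 -> params a1 -> params a2 ->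
  (forall e, a1 e <= a2 e) -> increasing f -> expect w1 a1 f <= expect w2 a2 f.
Proof.
move=> w10 w20 d11 d12 p1 p2 a12 incf.
have [s] : {s : seq E | forall e, e \notin s -> determined a1 e && determined a2 e}.
  by exists (enum E) => e; rewrite mem_enum.
elim: s => [|e s IH] in w2 a1 a2 f w20 d12 p1 p2 a12 incf * => ds.
  have d1 e : determined a1 e by case/andP: (ds e isT).
  have d2 e : determined a2 e by case/andP: (ds e isT).
  rewrite !expect_determined //; apply: incf; apply/subsetP => e.
  rewrite !inE => /eqP ae; have := a12 e; rewrite ae => a2e.
  by rewrite eq_le a2e andbT; case/andP: (p2 e).
have p01 : 0 <= (0 : R) <= 1 by rewrite lexx ler01.
have p11 : 0 <= (1 : R) <= 1 by rewrite lexx ler01.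
have dsx (b1 b2 : E -> R) x y : (x == 0) || (x == 1) -> (y == 0) || (y == 1) ->
    (forall e', e' != e -> e' \notin s -> determined b1 e' && determined b2 e') ->
    forall e', e' \notin s -> determined (update b1 e x) e' && determined (update b2 e y) e'.
  move=> dx dy db e' e's; rewrite /determined /update.
  by case: (eqVneq e' e) => [_|ne]; [rewrite dx dy|exact: db].
have ds' e' : e' != e -> e' \notin s -> determined a1 e' && determined a2 e'.
  by move=> ne e's; apply: ds; rewrite inE negb_or ne.
have ds1 e' : e' != e -> e' \notin s -> determined a1 e' && determined a1 e'.
  by move=> ne e's; case/andP: (ds' _ ne e's) => ->.
have ux (b1 b2 : E -> R) x y : x <= y -> (forall e, b1 e <= b2 e) ->
    forall e', update b1 e x e' <= update b2 e y e'.
  by move=> xy b12 e'; rewrite /update; case: eqP.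
rewrite (expect_split e f p1 w10) (expect_split e f p2 w20).
have bpos a w x : params a -> (forall A, 0 < w A) -> 0 <= x <= 1 -> 0 < bern (update a e x) w.
  by move=> pa w0 px; apply: bern_gt0 => //; apply: update_params.
have uD C : e |: (C :\ e) = e |: C by apply/setP => i; rewrite !inE; case: eqP.
apply: mix_le => //.
- by rewrite divr_gt0 // bpos.
- by rewrite divr_gt0 // bpos.
- rewrite !expect_odds //.
  have odds : expect w1 (update a1 e 0) (fun A => w1 (e |: A) / w1 (A :\ e))
    <= expect w2 (update a2 e 0) (fun A => w2 (e |: A) / w2 (A :\ e)).
    (* The increasing ratio of [w1] is first moved to the larger measure by induction, then replaced
       pointwise by the ratio of [w2]. *)
    apply: (@le_trans _ _ (expect w2 (update a2 e 0) (fun A => w1 (e |: A) / w1 (A :\ e)))).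
      apply: IH => //; [exact: update_params|exact: update_params|by apply: ux; rewrite ?lexx| |].
        move=> A B AB; rewrite ler_pdivrMr // [leRHS]mulrAC ler_pdivlMr //.
        have := d11 (A :\ e) (B :\ e) e (setSD _ AB).
        by rewrite setD11 !uD => /(_ isT).
      by apply: dsx; rewrite ?eqxx.
    apply: ler_expect => //; first exact: update_params.
    move=> A _; rewrite ler_pdivrMr // [leRHS]mulrAC ler_pdivlMr //.
    have := d12 (A :\ e) (A :\ e) e (subxx _).
    by rewrite setD11 uD => /(_ isT).
  have /andP[a10 a11] := p1 e; have /andP[a20 a21] := p2 e.
  set x := expect _ _ _ in odds *; set y := expect _ _ _ in odds *.
  have x0 : 0 <= x.
    have pu : params (update a1 e 0) by exact: update_params.
    rewrite -(expect_cst 0 pu w10); apply: ler_expect => // A _.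
    by rewrite divr_ge0 // ltW.
  have -> : a1 e * x * (1 - a2 e) = (a1 e * (1 - a2 e)) * x by ring.
  have -> : a2 e * y * (1 - a1 e) = (a2 e * (1 - a1 e)) * y by ring.
  apply: ler_pM => //; first by rewrite mulr_ge0 // subr_ge0.
  have := a12 e; lra.
- by apply: IH => //;
    [exact: update_params|exact: update_params|apply: ux|apply: dsx; rewrite ?eqxx].
- by apply: IH => //;
    [exact: update_params|exact: update_params|apply: ux|apply: dsx; rewrite ?eqxx ?orbT].
- by apply: IH => //;
    [exact: update_params|exact: update_params|apply: ux|apply: dsx; rewrite ?eqxx ?orbT].
Qed.

Lemma bern_indep a e x F : (forall A, F (e |: A) = F A) -> bern (update a e x) F = bern a F.
Proof.
move=> Fe; have eqo : bern (update a e 1) F = bern (update a e 0) F.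
  by rewrite bern_open; apply: eq_bern.
have uu y : update (update a e x) e y = update a e y.
  by apply/funext => e'; rewrite /update; case: eqP.
by rewrite (bern_split a e) (bern_split (update a e x) e) !uu update_id eqo; ring.
Qed.

Lemma bern_eq_off a b F : (forall e, a e = b e \/ forall A, F (e |: A) = F A) ->
  bern a F = bern b F.
Proof.
move=> ab; have [s] : {s : seq E | forall e, e \notin s -> a e = b e}.
  by exists (enum E) => e; rewrite mem_enum.
elim: s => [|e s IH] in a b ab * => abs.
  by congr bern; apply/funext => e; apply: abs.
have [abe|Fe] := ab e.
  apply: IH => // e' e's; case: (eqVneq e' e) => [->//|ne].
  by apply: abs; rewrite inE negb_or ne.
rewrite -(bern_indep a 0 Fe) -(bern_indep b 0 Fe); apply: IH => e'.
  by rewrite /update; case: eqP; [left|].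
move=> e's; rewrite /update; case: (eqVneq e' e) => // ne.
by apply: abs; rewrite inE negb_or ne.
Qed.

Lemma bern_determined a F : (forall e, determined a e) -> bern a F = F [set e | a e == 1].
Proof.
move=> da; rewrite -[RHS](bern_cst a); apply: eq_bern => A sA.
congr F; apply/setP => e; rewrite inE; have [s1 s0] := sA e.
case/orP: (da e) => /eqP ae; rewrite ae.
  by rewrite eq_sym oner_eq0; apply/negbTE/s0.
by rewrite eqxx s1.
Qed.

Lemma bern_ind (P : (E -> R) -> Prop) :
  (forall a, (forall e, determined a e) -> P a) ->
  (forall a e, P (update a e 0) -> P (update a e 1) -> P a) ->
  forall a, P a.
Proof.
move=> P0 PS a; have [s] : {s : seq E | forall e, e \notin s -> determined a e}.
  by exists (enum E) => e; rewrite mem_enum.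
elim: s => [|e s IH] in a * => ds; first by apply: P0 => e; apply: ds.
have dx x : (x == 0) || (x == 1) -> forall e', e' \notin s -> determined (update a e x) e'.
  move=> hx e' e's; rewrite /determined /update; case: (eqVneq e' e) => // ne.
  by apply: ds; rewrite inE negb_or ne.
by apply: (PS a e); apply: IH; apply: dx; rewrite eqxx ?orbT.
Qed.

(** Independence of the edges inside and outside [T]: each edge influences only one of the two
    factors. *)
Lemma bern_factor a (T : {set E}) F G :
  bern a (fun A => F (A :&: T) * G (A :\: T)) =
  bern a (fun A => F (A :&: T)) * bern a (fun A => G (A :\: T)).
Proof.
elim/bern_ind: a => [a da|a e IH0 IH1]; first by rewrite !bern_determined.
have [eT|eT] := boolP (e \in T).
  have Ge A : G ((e |: A) :\: T) = G (A :\: T).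
    by congr G; apply/setP => i; rewrite !inE; case: eqP => // ->; rewrite eT.
  move: IH0 IH1; rewrite !(bern_indep a _ Ge) => IH0 IH1.
  by rewrite (bern_split a e) IH0 IH1 (bern_split a e (fun A => F _)); ring.
have Fe A : F ((e |: A) :&: T) = F (A :&: T).
  congr F; apply/setP => i; rewrite !inE; case: eqP => // ->.
  by rewrite (negbTE eT) !andbF.
move: IH0 IH1; rewrite !(bern_indep a _ Fe) => IH0 IH1.
by rewrite (bern_split a e) IH0 IH1 (bern_split a e (fun A => G _)); ring.
Qed.

End Bernoulli.

(** A marginal of a product measure is a product measure. This brings two graphs with different edge
    sets onto one space. *)
Lemma bern_preim (R : realFieldType) (E1 E2 : finType) (j : E1 -> E2) (a : E2 -> R)
    (F : {set E1} -> R) : injective j ->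
  bern a (fun A => F [set e | j e \in A]%SET) = bern (a \o j) F.
Proof.
move=> jI; have [s] : {s : seq E1 | forall e, e \notin s -> determined (a \o j) e}.
  by exists (enum E1) => e; rewrite mem_enum.
elim: s => [|e s IH] in a * => ds.
  rewrite [RHS]bern_determined => [|e]; last by apply: ds.
  rewrite -[RHS](bern_cst a); apply: eq_bern => A sA; congr F.
  apply/setP => e; rewrite !inE /=; have [s1 s0] := sA (j e).
  case/orP: (ds e isT) => /= /eqP ae; rewrite ae.
    by rewrite eq_sym oner_eq0; apply/negbTE/s0.
  by rewrite eqxx s1.
have ux x : update a (j e) x \o j = update (a \o j) e x.
  by apply/funext => e'; rewrite /update /= (inj_eq jI).
rewrite (bern_split a (j e)) (bern_split (a \o j) e) -!ux !IH // => e' e's; rewrite ux;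
  rewrite /determined /update; case: (eqVneq e' e) => [_|ne]; rewrite ?eqxx ?orbT //;
  by apply: ds; rewrite inE negb_or ne.
Qed.

(** * Clusters of a wired graph *)

Section WiredGraph.
Import mathcomp.boot.fintype mathcomp.boot.fingraph mathcomp.boot.finset.
Variables (V E : finType) (r : rel V) (src tgt : E -> V).
Hypothesis r_sym : symmetric r.
Implicit Types (A B T : {set E}) (e : E) (u v x y : V).

Definition ends e u v :=
  (src e == u) && (tgt e == v) || (src e == v) && (tgt e == u).

Definition wadj A : rel V := fun u v => r u v || [exists e in A, ends e u v].

Definition cluster A x : {set V} := [set y | connect (wadj A) x y].

Definition clusters A : {set {set V}} := [set cluster A x | x in V].

Lemma ends_sym e u v : ends e u v = ends e v u.
Proof. by rewrite /ends orbC. Qed.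

Lemma wadj_sym A : symmetric (wadj A).
Proof.
move=> u v; rewrite /wadj r_sym; congr (_ || _); apply: eq_existsb => e.
by rewrite ends_sym.
Qed.

Lemma wconnect_sym A : connect_sym (wadj A).
Proof. exact/sym_connect_sym/wadj_sym. Qed.

Lemma mem_cluster A x : x \in cluster A x.
Proof. by rewrite inE connect0. Qed.

Lemma cluster_sym A x y : (y \in cluster A x) = (x \in cluster A y).
Proof. by rewrite !inE wconnect_sym. Qed.

Lemma eq_cluster A x y : y \in cluster A x -> cluster A y = cluster A x.
Proof.
move=> xy; apply/setP => z; rewrite !inE; rewrite inE in xy.
exact/esym/(same_connect (@wconnect_sym A)).
Qed.

Lemma cluster_mono A B x : A \subset B -> cluster A x \subset cluster B x.
Proof.
move=> /subsetP AB; apply/subsetP => y; rewrite !inE; apply: connect_sub => u v uv.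
apply: connect1; case/orP: uv => [ruv|/existsP[e /andP[eA euv]]]; rewrite /wadj ?ruv //.
by apply/orP; right; apply/existsP; exists e; rewrite AB.
Qed.

Lemma card_clusters A : n_comp (wadj A) predT = #|clusters A|.
Proof.
rewrite /n_comp_mem.
have -> : clusters A = [set cluster A x | x in [predI roots (wadj A) & predT]].
  apply/setP => X; apply/imsetP/imsetP => [[x _ ->]|[x _ ->]]; last by exists x.
  exists (root (wadj A) x).
    by rewrite !inE andbT roots_root //; exact: wconnect_sym.
  by apply/esym/eq_cluster; rewrite inE connect_root.
rewrite card_in_imset // => x y /andP[rx _] /andP[ry _] /setP/(_ y).
rewrite mem_cluster inE => /(rootP (@wconnect_sym A)).
by rewrite (eqP rx) (eqP ry).
Qed.

Lemma connect_closed_eq (e1 e2 : rel V) (X : {set V}) x :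
  x \in X -> (forall u v, u \in X -> e1 u v -> v \in X) ->
  (forall u v, u \in X -> e1 u v = e2 u v) -> connect e1 x =1 connect e2 x.
Proof.
move=> xX clX e12 y; apply/connectP/connectP => -[p]; last first.
  elim: p x xX => [|z p IH] x xX /=; first by move=> _ ->; exists [::].
  move=> /andP[xz zp] yE; rewrite -e12 // in xz.
  have [p' pp' lp'] := IH z (clX _ _ xX xz) zp yE.
  by exists (z :: p') => //=; rewrite xz.
elim: p x xX => [|z p IH] x xX /=; first by move=> _ ->; exists [::].
move=> /andP[xz zp] yE.
have [p' pp' lp'] := IH z (clX _ _ xX xz) zp yE.
by exists (z :: p') => //=; rewrite -e12 // xz.
Qed.

Lemma cluster_closed A x u v : u \in cluster A x -> wadj A u v -> v \in cluster A x.
Proof. by rewrite !inE => xu uv; apply: connect_trans xu (connect1 uv). Qed.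

Lemma cluster_add A e u v x : ends e u v ->
  cluster (e |: A) x = if x \in cluster A u :|: cluster A v
    then cluster A u :|: cluster A v else cluster A x.
Proof.
move=> euv.
have adde w z : wadj (e |: A) w z = wadj A w z || ends e w z.
  rewrite /wadj -orbA; congr (_ || _); apply/existsP/orP => [[e' /andP[]]|].
    rewrite in_setU1 => /orP[/eqP-> ->|e'A wz]; first by right.
    by left; apply/existsP; exists e'; rewrite e'A.
  move=> [/existsP[e' /andP[e'A wz]]|wz]; last by exists e; rewrite setU11.
  by exists e'; rewrite in_setU1 e'A orbT.
have uv_e : wadj (e |: A) u v by rewrite adde euv orbT.
have sub w : cluster A w \subset cluster (e |: A) w by apply/cluster_mono/subsetUr.
have vu : v \in cluster (e |: A) u by rewrite inE connect1.
have subuv : cluster A u :|: cluster A v \subset cluster (e |: A) u.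
  by rewrite subUset sub /= -(eq_cluster vu) sub.
have endsP w z : ends e w z -> (w = u /\ z = v) \/ (w = v /\ z = u).
  by case/orP: euv => /andP[/eqP su /eqP tv]; case/orP=> /andP[/eqP<- /eqP<-];
    rewrite su tv; [left|right|right|left].
case: ifPn => [xuv|].
  rewrite (@eq_cluster _ u x) ?(subsetP subuv) //.
  apply/eqP; rewrite eqEsubset subuv andbT; apply/subsetP => z.
  rewrite inE => /connectP[p pp ->] {z}.
  set U := cluster A u :|: cluster A v.
  have stay w w' : w \in U -> wadj (e |: A) w w' -> w' \in U.
    move=> wU; rewrite adde => /orP[wz|/endsP[[_ ->]|[_ ->]]]; last 2 first.
    - by rewrite inE mem_cluster orbT.
    - by rewrite inE mem_cluster.
    by move: wU; rewrite !in_setU => /orP[]/cluster_closed/(_ wz)->; rewrite ?orbT.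
  have : u \in U by rewrite inE mem_cluster.
  elim: p (u) pp => [//|z p IH] w /= /andP[wz zp] wU.
  by apply: IH zp _; apply: stay wz.
rewrite inE negb_or => /andP[xu xv]; apply/setP => z; rewrite [LHS]inE [RHS]inE.
apply/esym/(@connect_closed_eq _ _ (cluster A x)); first exact: mem_cluster.
  by move=> w w'; apply: cluster_closed.
move=> w w' xw; rewrite adde; case: (boolP (ends e w w')) => [|_]; last by rewrite orbF.
by case/endsP => -[ww _]; [case/negP: xu|case/negP: xv]; rewrite cluster_sym -ww.
Qed.

Lemma card_clusters_add A e u v : ends e u v ->
  #|clusters A| = (#|clusters (e |: A)| + (v \notin cluster A u))%N.
Proof.
move=> euv; case: (boolP (v \in cluster A u)) => [vu|vu] /=; rewrite ?addn0 ?addn1.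
  congr #|pred_of_set _|; apply: eq_imset => x; rewrite (cluster_add _ _ euv).
  rewrite (eq_cluster vu) setUid; case: ifP => // xu; exact: eq_cluster.
set C := cluster A u; set D := cluster A v.
have nCD : C != D by apply: contraNneq vu => CD; rewrite -/C CD mem_cluster.
have C_in : C \in clusters A by apply: imset_f.
have D_in : D \in clusters A :\ C.
  by rewrite !inE eq_sym nCD; apply: imset_f.
rewrite (cardsD1 C) C_in (cardsD1 D) D_in /= add1n add1n; congr _.+1.
have -> : clusters (e |: A) = (C :|: D) |: (clusters A :\ C :\ D).
  apply/setP => X; rewrite in_setU1; apply/imsetP/orP.
    move=> [x _ ->]; rewrite (cluster_add _ _ euv); case: ifPn => [_|]; first by left.
    rewrite inE negb_or => /andP[xC xD]; right; rewrite !inE imset_f // andbT.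
    by apply/andP; split; [apply: contraNneq xD|apply: contraNneq xC];
      rewrite -/C -/D => XE; rewrite -XE mem_cluster.
  move=> [/eqP->|].
    by exists u => //; rewrite (cluster_add _ _ euv) inE mem_cluster.
  rewrite !inE => /and3P[XD XC /imsetP[x _ Xx]]; exists x => //.
  rewrite (cluster_add _ _ euv) ifN // inE negb_or; apply/andP.
  by split; [apply: contraNN XC|apply: contraNN XD] => /eq_cluster; rewrite Xx => ->.
rewrite cardsU1 (_ : _ \notin _ = true) ?add1n //; apply/negP.
rewrite !inE => /and3P[_ CDC /imsetP[x _ CDx]].
have : u \in cluster A x by rewrite -CDx inE mem_cluster.
by move=> /eq_cluster; rewrite -CDx -/C => CC; rewrite -CC eqxx in CDC.
Qed.

Definition touching (X : {set V}) : {set E} := [set e | (src e \in X) || (tgt e \in X)].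

Lemma wadj_touching A (X : {set V}) u v : u \in X ->
  wadj A u v = wadj (A :&: touching X) u v.
Proof.
move=> uX; rewrite /wadj; congr (_ || _); apply: eq_existsb => e; rewrite !inE.
case: (boolP (ends e u v)) => [euv|]; rewrite ?andbF //.
by case/orP: euv => /andP[/eqP-> /eqP->]; rewrite uX ?orbT !andbT.
Qed.

(** As long as a path stays in [X], it uses only edges touching [X]. Hence the event that the
    cluster is [X] is independent of all the other edges. *)
Lemma cluster_touching A (X : {set V}) x :
  (cluster A x == X) = (cluster (A :&: touching X) x == X).
Proof.
apply/eqP/eqP => [<-|cX].
  apply/setP => y; rewrite [LHS]inE [RHS]inE; apply/esym.
  apply: (@connect_closed_eq _ _ (cluster A x)) => [|u v|u v]; first exact: mem_cluster.
    exact: cluster_closed.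
  exact: wadj_touching.
rewrite -[RHS]cX; apply/setP => y; rewrite [LHS]inE [RHS]inE; apply/esym.
apply: (@connect_closed_eq _ _ X) => [|u v uX|u v uX]; first by rewrite -cX mem_cluster.
  by move=> uv; rewrite -cX; apply: cluster_closed uv; rewrite cX.
by rewrite -wadj_touching.
Qed.

Lemma cluster_off A x y : y \notin cluster A x ->
  cluster A y = cluster (A :\: touching (cluster A x)) y.
Proof.
move=> yx; apply/setP => z; rewrite [LHS]inE [RHS]inE.
have out u v : u \in ~: cluster A x -> wadj A u v -> v \in ~: cluster A x.
  rewrite !in_setC => ux uv; apply: contraNN ux => vx.
  by apply: cluster_closed vx _; rewrite wadj_sym.
apply: (@connect_closed_eq _ _ (~: cluster A x)) => //; first by rewrite in_setC.
move=> u v ux; apply/idP/idP => [uv|].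
  have vx := out _ _ ux uv; move: uv; rewrite /wadj => /orP[->//|/existsP[e /andP[eA euv]]].
  apply/orP; right; apply/existsP; exists e; rewrite euv andbT in_setD eA andbT.
  move: ux vx; rewrite !in_setC => ux vx.
  by rewrite inE negb_or; case/orP: euv => /andP[/eqP-> /eqP->]; rewrite ux vx.
rewrite /wadj => /orP[->//|/existsP[e /andP[]]]; rewrite in_setD => /andP[_ eA] euv.
by apply/orP; right; apply/existsP; exists e; rewrite eA.
Qed.

(** Closing the edges that touch [X] keeps the other clusters and breaks [X] into its wiring
    classes, the sets [cluster set0 y]. Their number depends on [X] only, so it contributes a
    constant factor once the cluster is fixed. *)
Lemma clusters_off A x : let X := cluster A x in
  (#|clusters A| + #|[set cluster set0 y | y in X]|)%N
    = (#|clusters (A :\: touching X)|).+1.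
Proof.
move=> X; pose Q := [set cluster A y | y in ~: X].
have cA : clusters A = X |: Q.
  apply/setP => Y; apply/imsetP/setU1P => [[y _ ->]|[->|/imsetP[y _ ->]]]; last 2 first.
  - by exists x.
  - by exists y.
  have [yX|yX] := boolP (y \in X); first by left; apply: eq_cluster.
  by right; apply: imset_f; rewrite in_setC.
have XQ : X \notin Q.
  apply/negP => /imsetP[y]; rewrite in_setC => yX XE; case/negP: yX.
  by rewrite XE mem_cluster.
pose B := A :\: touching X.
have BX y : y \in X -> cluster B y = cluster set0 y.
  move=> yX; apply/setP => z; rewrite [LHS]inE [RHS]inE.
  have subB u v : u \in X -> wadj B u v = wadj set0 u v.
    move=> uX; rewrite (wadj_touching _ _ uX); congr (wadj _ u v).
    by apply/setP => e; rewrite in_setI in_setD in_set0; case: (e \in touching X); rewrite ?andbF.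
  apply: (@connect_closed_eq _ _ X) => //.
  move=> u v uX; rewrite subB // /X => uv; apply: cluster_closed uX _.
  by case/orP: uv => [ruv|/existsP[e]]; [rewrite /wadj ruv|rewrite inE].
have BQ y : y \in ~: X -> cluster B y = cluster A y.
  by rewrite in_setC => yX; rewrite -cluster_off.
have cB : clusters B = [set cluster set0 y | y in X] :|: Q.
  apply/setP => Y; rewrite in_setU; apply/imsetP/orP => [[y _ ->]|].
    have [yX|yX] := boolP (y \in X); first by left; rewrite BX // imset_f.
    by right; rewrite BQ ?in_setC // imset_f // in_setC.
  by case=> /imsetP[y yX ->]; exists y => //; [rewrite BX|rewrite BQ].
rewrite cB cA cardsU1 XQ cardsU (_ : _ :&: Q = set0) ?cards0 ?subn0; last first.
  apply/setP => Y; rewrite in_setI in_set0; apply/negP => /andP[/imsetP[y yX ->] /imsetP[z zX]].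
  move=> yz; move: zX; rewrite in_setC => /negP; apply.
  have yz' : y \in cluster A z by rewrite -yz mem_cluster.
  by rewrite /X -(eq_cluster yX) cluster_sym.
by rewrite add1n addSn addnC.
Qed.

End WiredGraph.

(** * Comparison with the tilted measure *)

Section ClusterWeight.
Import mathcomp.boot.fintype mathcomp.boot.fingraph mathcomp.boot.finset.
Variables (R : realFieldType) (V E : finType) (r : rel V) (src tgt : E -> V) (q : R).
Hypotheses (r_sym : symmetric r) (q_ge1 : 1 <= q).
Implicit Types (A B T S U : {set E}) (e : E) (u v x y : V) (a : E -> R).

Local Notation cl := (cluster r src tgt).

Definition cweight A : R := q ^+ #|clusters r src tgt A|.

Let q_gt0 : 0 < q. Proof. exact: lt_le_trans ltr01 q_ge1. Qed.

Let qV_le1 : q^-1 <= 1. Proof. by rewrite invf_le1. Qed.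

Lemma cweight_gt0 A : 0 < cweight A.
Proof. exact: exprn_gt0. Qed.

Lemma ends_src_tgt e : ends src tgt e (src e) (tgt e).
Proof. by rewrite /ends !eqxx. Qed.

Lemma cweight_add A e u v : ends src tgt e u v ->
  cweight (e |: A) = cweight A * (if v \in cl A u then 1 else q^-1).
Proof.
move=> euv; rewrite /cweight (card_clusters_add r_sym A euv) exprD.
by case: ifP => _ /=; rewrite ?(expr0, expr1, mulr1) // mulfK // gt_eqF.
Qed.

(** Opening an edge multiplies the weight by 1 if its ends are already connected and by [q^-1]
    otherwise. For [q >= 1] this factor is increasing in the configuration, which is the FKG lattice
    condition. *)
Lemma cweight_dominated : dominated cweight cweight.
Proof.
move=> A B e AB _; rewrite !(cweight_add _ (ends_src_tgt e)).
have /subsetP sub := cluster_mono r src tgt (src e) AB.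
set c := if _ then _ else _; set d := if _ then _ else _.
have cd : c <= d by rewrite /c /d; case: ifP => [/sub->//|_]; case: ifP.
have := ler_wpM2l (mulr_ge0 (ltW (cweight_gt0 A)) (ltW (cweight_gt0 B))) cd.
lra.
Qed.

Section Key.
Variables (x : V) (g : {set V} -> R) (eps : R) (a0 : E -> R).
Hypotheses (g_gt0 : forall X, 0 < g X)
  (g_anti : forall X Y : {set V}, X \subset Y -> g Y <= g X)
  (g_mul : forall X Y : {set V}, g X * g Y <= g (X :|: Y))
  (eps_ge0 : 0 <= eps) (eps_le1 : eps <= 1) (a0_params : params a0)
  (g_small : forall y, 1 - eps <= expect cweight a0 (fun A => g (cl A y))).

(** [a] may exceed [a0] only on edges issued from the explored cluster. Testing [src e] suffices,
    since an edge found open during the exploration has both ends there. *)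
Let explored a S := (forall e, e \in S -> a e = 1) /\
  (forall e, a e <= a0 e \/ src e \in cl S x).

(* Conditionally on C_x = X, the edges that do not touch X form a random-cluster model in
   which the edges touching X are closed. *)
Lemma bern_cluster_eq a (X : {set V}) y (h : {set V} -> R) : y \notin X ->
  let T := touching src tgt X in
  let aT e := if e \in T then 0 else a e in
  bern a (fun A => cweight A * ((cl A x == X)%:R * h (cl A y))) =
  q / q ^+ #|[set cl set0 z | z in X]| * bern a (fun A => (cl (A :&: T) x == X)%:R)
    * bern aT (fun A => cweight A * h (cl A y)).
Proof.
move=> yX T aT; set K := q / _.
rewrite (@eq_bern _ _ a _ (fun A => K * ((cl (A :&: T) x == X)%:R *
    (cweight (A :\: T) * h (cl (A :\: T) y))))); last first.
  move=> A _; rewrite -cluster_touching; case: eqP => [AX|_]; last first.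
    by rewrite !mul0r !mulr0.
  rewrite !mul1r mulrA /T -AX -(cluster_off r_sym) ?AX //; congr (_ * _).
  rewrite /K /cweight -AX mulrAC -exprS -(clusters_off src tgt r_sym) exprD mulfK //.
  by rewrite gt_eqF // exprn_gt0.
rewrite bernZ -mulrA; congr (_ * _).
rewrite (bern_factor a T (fun B => (cl B x == X)%:R) (fun B => cweight B * h (cl B y))).
congr (_ * _); rewrite (@bern_eq_off _ _ a aT); last first.
  move=> e; rewrite /aT; case: ifP => eT; [right => A|by left].
  have -> // : (e |: A) :\: T = A :\: T.
  by apply/setP => i; rewrite in_setD in_setU1 in_setD; case: eqP => // ->; rewrite eT.
apply: eq_bern => A sA; have -> // : A :\: T = A.
apply/setP => e; rewrite in_setD; case: (boolP (e \in T)) => //= eT.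
by apply/esym/negbTE/(sA e).2; rewrite /aT eT.
Qed.

(** Once [C_x] is fixed to a set avoiding [y], the cluster of [y] lives in a model with parameters
    at most [a0]. There the mean of the decreasing function [g (C_y)] is at least its mean under
    [a0]. *)
Lemma bern_cluster_disjoint a S y : params a -> explored a S ->
  (1 - eps) * bern a (fun A => cweight A * ((y \notin cl A x)%:R * g (cl A x)))
  <= bern a (fun A => cweight A * ((y \notin cl A x)%:R * g (cl A x) * g (cl A y))).
Proof.
move=> pa [aS aa0].
have decomp (h : {set V} -> R) :
    bern a (fun A => cweight A * ((y \notin cl A x)%:R * g (cl A x) * h (cl A y))) =
    \sum_(X : {set V}) (y \notin X)%:R * g X *
      bern a (fun A => cweight A * ((cl A x == X)%:R * h (cl A y))).
  under [RHS]eq_bigr do rewrite -bernZ.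
  rewrite -bern_sum; apply: eq_bern => A _.
  rewrite (bigD1 (cl A x)) //= big1 ?addr0 => [|X XA].
    by rewrite eqxx mul1r; ring.
  by rewrite eq_sym (negbTE XA) mul0r !mulr0.
rewrite decomp; have := decomp (fun=> 1).
under [X in X = _]eq_bern do rewrite mulr1.
move=> ->; rewrite big_distrr; apply: ler_sum => X _ /=.
case: (boolP (y \in X)) => yX; rewrite ?mul0r ?mulr0 // !mul1r mulrCA ler_pM2l //.
(* If no supported set has cluster [X], both sides vanish. Otherwise [X] contains [cl S x], so the
   edges where [a] exceeds [a0] touch [X] and are closed in [aT]. *)
have [[A0 sA0 A0X]|none] := pselect (exists2 A0, supported a A0 & cl A0 x = X); last first.
  rewrite !(@eq_bern _ _ a _ (fun=> 0)) ?bern_cst ?mulr0 // => A sA;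
  by case: eqP => [AX|_]; [case: none; exists A|rewrite mul0r mulr0].
rewrite (bern_cluster_eq _ (fun=> 1) yX) (bern_cluster_eq _ _ yX).
set T := touching _ _ _; set aT := fun e => _.
have paT : params aT by move=> e; rewrite /aT; case: ifP => // _; rewrite lexx ler01.
rewrite mulrCA ler_wpM2l //.
  rewrite mulr_ge0 //; first by rewrite divr_ge0 ?exprn_ge0 // ltW.
  by apply: bern_ge0.
rewrite (@eq_bern _ _ aT _ cweight) => [|A _]; last by rewrite mulr1.
rewrite -ler_pdivlMr ?bern_gt0 //; last exact: cweight_gt0.
apply: le_trans (g_small y) _.
rewrite -lerN2 -[leLHS]mulN1r -[leRHS]mulN1r -!expectZ; apply: expect_mono => //.
- exact: cweight_gt0.
- exact: cweight_gt0.
- exact: cweight_dominated.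
- exact: cweight_dominated.
- move=> e; rewrite /aT; case: ifP => [_|eT]; first by case/andP: (a0_params e).
  have [//|eS] := aa0 e; case/negP: eT; rewrite inE -A0X.
  have SA0 : S \subset A0 by apply/subsetP => i /aS; apply: (sA0 i).1.
  by rewrite (subsetP (cluster_mono r src tgt x SA0)).
- move=> A B AB; rewrite !mulN1r lerN2; apply: g_anti; exact: cluster_mono.
Qed.

Let tilted A := cweight A * g (cl A x).

Let tilted_gt0 A : 0 < tilted A.
Proof. by rewrite mulr_gt0 ?cweight_gt0. Qed.

(** If [v] is already in [C_x], opening [e] changes neither the weight nor [C_x]. Otherwise it costs
    [q^-1] and merges [C_v] into [C_x]; by [g_mul] the tilt then loses at most the factor [g (C_v)],
    whose mean effect is bounded by [bern_cluster_disjoint]. *)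
Let expect_tilted_odds a S e u v : params a -> explored a S -> ends src tgt e u v ->
  u \in cl S x -> explored (update a e 0) S ->
  (1 - eps) * expect tilted (update a e 0) (fun A => if v \in cl A x then 1 else q^-1)
  <= bern (update a e 1) tilted / bern (update a e 0) tilted.
Proof.
move=> pa ex euv uS ex0; have pa0 : params (update a e 0).
  by apply: update_params; rewrite ?lexx ?ler01.
rewrite mulrA ler_pM2r ?invr_gt0 ?bern_gt0 // bern_open.
have -> : bern (update a e 0) (fun A => tilted A * (if v \in cl A x then 1 else q^-1)) =
   bern (update a e 0) (fun A => cweight A * ((v \in cl A x)%:R * g (cl A x))) +
   q^-1 * bern (update a e 0) (fun A => cweight A * ((v \notin cl A x)%:R * g (cl A x))).
  rewrite -bernZ -bernD; apply: eq_bern => A _; rewrite /tilted.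
  by case: ifP => _ /=; ring.
have ge0 : 0 <= bern (update a e 0) (fun A => cweight A * ((v \in cl A x)%:R * g (cl A x))).
  by apply: bern_ge0 => // A; rewrite !mulr_ge0 ?ler0n // ltW // cweight_gt0.
apply: (@le_trans _ _
    (bern (update a e 0) (fun A => cweight A * ((v \in cl A x)%:R * g (cl A x)))
     + q^-1 * bern (update a e 0)
         (fun A => cweight A * ((v \notin cl A x)%:R * g (cl A x) * g (cl A v))))).
  rewrite mulrDr lerD //; first by rewrite ler_piMl // lerBlDr lerDl.
  rewrite mulrCA ler_pM2l ?invr_gt0 //; exact: bern_cluster_disjoint ex0.
rewrite -bernZ -bernD; apply: ler_bern => // A sA.
have SA : S \subset A by apply/subsetP => i iS; apply: (sA i).1; apply: ex0.1.
have uA : u \in cl A x by rewrite (subsetP (cluster_mono r src tgt x SA)).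
rewrite /tilted (cweight_add _ euv) (cluster_add r_sym A x euv) (eq_cluster r_sym uA).
rewrite in_setU mem_cluster /=.
case: (boolP (v \in cl A x)) => vA /=.
  rewrite (eq_cluster r_sym vA) setUid; lra.
rewrite mul0r mulr0 add0r mul1r mulrCA -mulrA ler_pM2l ?cweight_gt0 //.
by rewrite ler_pM2l ?invr_gt0.
Qed.

(* Exploration of C_x: S is the set of edges found open and U the set of edges not yet
   explored. Every edge of S touches C_x(S), so the graph outside C_x(S) is as under a0. *)
Lemma expect_tilted a a' (F : {set V} -> R) :
  params a -> params a' -> (forall e, a e <= a0 e) ->
  (forall e, a' e * (1 - a e) <= (1 - eps) * (a e * (1 - a' e))) ->
  (forall X Y : {set V}, X \subset Y -> F X <= F Y) ->
  expect cweight a' (fun A => F (cl A x)) <= expect tilted a (fun A => F (cl A x)).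
Proof.
move=> pa pa' aa0 aa' incF.
have : explored a set0 by split=> [e|e]; [rewrite inE|left].
have : forall e, e \in (set0 : {set E}) -> a' e = 1 by move=> e; rewrite inE.
have : forall e, e \notin [set: E] -> e \in (set0 : {set E}) \/ a e = 0 /\ a' e = 0.
  by move=> e; rewrite inE.
have : forall e, e \in (set0 : {set E}) -> e \notin [set: E] by move=> e; rewrite inE.
have [n] := ubnP #|[set: E]|.
elim: n (set0 : {set E}) [set: E] => [//|n IH] S U in a a' pa pa' aa' {aa0} F incF *.
move=> Un SU detU a'S ex.
pose frontier e := (e \in U) && ((src e \in cl S x) || (tgt e \in cl S x)).
(* Without frontier edges, [C_x] equals [cl S x] almost surely under both measures, and both sides
   are [F (cl S x)]. *)
have [e /andP[eU eS]|noe] := pickP frontier; last first.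
  have cS (b : E -> R) A : (forall e, e \in S -> b e = 1) ->
      (forall e, e \notin U -> e \in S \/ b e = 0) -> supported b A -> cl A x = cl S x.
    move=> bS bU sA; apply/eqP; rewrite cluster_touching.
    rewrite (_ : A :&: _ = S :&: touching src tgt (cl S x)) -?cluster_touching //.
    apply/setP => e; rewrite !in_setI.
    case: (boolP (e \in touching _ _ _)); rewrite ?andbF // !andbT => eT.
    have eU : e \notin U.
      by have /negbT := noe e; rewrite /frontier negb_and; rewrite inE in eT; rewrite eT orbF.
    have [eS|be] := bU e eU; first by rewrite eS; apply: (sA e).1; apply: bS.
    rewrite (negbTE ((sA e).2 be)); apply/esym/negP => /bS; rewrite be => /eqP.
    by rewrite eq_sym oner_eq0.
  rewrite (@eq_expect _ _ _ _ _ (fun=> F (cl S x))) => [|A sA]; last first.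
    by rewrite (cS a') // => e /detU[|[]]; [left|right].
  rewrite [leRHS](@eq_expect _ _ _ _ _ (fun=> F (cl S x))) => [|A sA]; last first.
    by rewrite (cS a) //; [exact: ex.1|move=> e /detU[|[]]; [left|right]].
  by rewrite !expect_cst // => A; exact: cweight_gt0.
have [u [v [euv uS]]] : exists u v, ends src tgt e u v /\ u \in cl S x.
  case/orP: eS => [sS|tS]; first by exists (src e), (tgt e); rewrite ends_src_tgt.
  by exists (tgt e), (src e); rewrite ends_sym ends_src_tgt.
have p01 : 0 <= (0 : R) <= 1 by rewrite lexx ler01.
have p11 : 0 <= (1 : R) <= 1 by rewrite lexx ler01.
have Un' : (#|U :\ e| < n)%N by move: Un; rewrite (cardsD1 e U) eU.
have eS' : e \notin S by apply: contraL eU => /SU.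
have upd_det (t : R) e' : (t \in [:: 0; 1]) -> e' \notin U :\ e ->
    e' \in (if t == 0 then S else e |: S) \/ update a e t e' = 0 /\ update a' e t e' = 0.
  rewrite !inE /update negb_and negbK => tE; case: (eqVneq e' e) => [-> _|ne /= e'U].
    by case: eqP => [->|_]; [right|left; rewrite setU11].
  by case: (detU _ e'U) => [e'S|]; [left; case: ifP => // _; rewrite in_setU1 e'S orbT|right].
have oddsx (t : R) e' : t \in [:: 0; 1] ->
    update a' e t e' * (1 - update a e t e')
      <= (1 - eps) * (update a e t e' * (1 - update a' e t e')).
  rewrite !inE /update => tE; case: eqP => // _.
  by case/orP: tE => /eqP->; rewrite ?subrr ?subr0 ?mul0r ?mulr0.
have in0 : (0 : R) \in [:: 0; 1] by rewrite !inE eqxx.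
have in1 : (1 : R) \in [:: 0; 1] by rewrite !inE eqxx orbT.
have ex0 : explored (update a e 0) S.
  split=> e'; rewrite /update; case: (eqVneq e' e) => [->|_]; first by rewrite (negbTE eS').
  - exact: ex.1.
  - by left; case/andP: (a0_params e).
  - exact: ex.2.
have subS y : y \in cl S x -> y \in cl (e |: S) x.
  by apply/subsetP/cluster_mono/subsetUr.
have ex1 : explored (update a e 1) (e |: S).
  split=> e'; rewrite /update; case: (eqVneq e' e) => [->|ne] //.
  - by rewrite in_setU1 (negbTE ne); apply: ex.1.
  - right; have uS' := subS _ uS.
    have vS' : v \in cl (e |: S) x.
      apply: cluster_closed uS' _; apply/orP; right; apply/existsP; exists e.
      by rewrite setU11.
    by case/orP: euv => /andP[/eqP-> _].
  - by case: (ex.2 e') => [|/subS]; [left|right].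
(* Kept general in [G]: it serves for [F] and for the odds factor [H] below. *)
have IH0 (G : {set V} -> R) : (forall X Y : {set V}, X \subset Y -> G X <= G Y) ->
    expect cweight (update a' e 0) (fun A => G (cl A x))
      <= expect tilted (update a e 0) (fun A => G (cl A x)).
  move=> incG; apply: (IH S (U :\ e)) => //.
  - exact: update_params.
  - exact: update_params.
  - by move=> e'; apply: oddsx.
  - by move=> e' /SU e'U; rewrite in_setD negb_and e'U orbT.
  - by move=> e' e'U; have := upd_det 0 e' in0 e'U; rewrite eqxx.
  - move=> e' e'S; rewrite /update; case: (eqVneq e' e) => [ee|_]; last exact: a'S.
    by rewrite ee (negbTE eS') in e'S.
have IH1 : expect cweight (update a' e 1) (fun A => F (cl A x))
    <= expect tilted (update a e 1) (fun A => F (cl A x)).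
  apply: (IH (e |: S) (U :\ e)) => //.
  - exact: update_params.
  - exact: update_params.
  - by move=> e'; apply: oddsx.
  - move=> e'; rewrite in_setU1 in_setD1 => /orP[->//|/SU e'U].
    by rewrite negb_and e'U orbT.
  - by move=> e' e'U; have := upd_det 1 e' in1 e'U; rewrite oner_eq0.
  - move=> e'; rewrite in_setU1 /update; case: (eqVneq e' e) => //= _; exact: a'S.
rewrite (expect_split e _ pa' cweight_gt0) (expect_split e _ pa tilted_gt0).
have bpos (b : E -> R) w (t : R) : params b -> (forall A, 0 < w A) -> 0 <= t <= 1 ->
    0 < bern (update b e t) w.
  by move=> pb w0 px; apply: bern_gt0 => //; apply: update_params.
apply: mix_le => //; [by rewrite divr_gt0 // bpos // => A; exact: cweight_gt0|
  by rewrite divr_gt0 // bpos| |exact: IH0|]; last first.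
  (* Opening [e] must raise the mean of [F] only under the untilted weight, which satisfies the
     lattice condition. *)
  apply: expect_mono => //; try exact: cweight_gt0; try exact: cweight_dominated;
    try exact: update_params.
    by move=> e'; rewrite /update; case: eqP.
  by move=> A B AB; apply: incF; apply: cluster_mono.
set H := fun X : {set V} => if v \in X then 1 else q^-1.
have incH (X Y : {set V}) : X \subset Y -> H X <= H Y.
  by move=> /subsetP XY; rewrite /H; case: ifP => [/XY->//|_]; case: ifP.
set Z' := _ / _; set Z := _ / _.
(* [Z'] is the untilted mean of [H] given that [e] is closed. Induction bounds it by the tilted
   mean, and [expect_tilted_odds] bounds [1 - eps] times the latter by [Z]; the loss is absorbed by
   the hypothesis [aa']. *)
have ZZ : (1 - eps) * Z' <= Z.
  apply: le_trans (expect_tilted_odds pa ex euv uS ex0).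
  rewrite ler_wpM2l ?subr_ge0 // /Z' expect_odds //; last exact: cweight_gt0.
  apply: le_trans (IH0 H incH).
  rewrite le_eqVlt; apply/orP; left; apply/eqP; apply: eq_expect => A sA.
  have SA : S \subset A.
    apply/subsetP => i iS; apply: (sA i).1; rewrite /update.
    by case: eqP => [ie|_]; [rewrite ie (negbTE eS') in iS|exact: a'S].
  have uA : u \in cl A x by rewrite (subsetP (cluster_mono r src tgt x SA)).
  have eA : e \notin A by apply: (sA e).2; rewrite update_id.
  have -> : A :\ e = A by apply/setDidPl; rewrite disjoint_sym disjoints1.
  rewrite (cweight_add _ euv) mulrAC divff ?gt_eqF ?cweight_gt0 // mul1r.
  by rewrite /H (eq_cluster r_sym uA).
have Z'0 : 0 < Z' by rewrite divr_gt0 // bpos // => A; exact: cweight_gt0.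
have /andP[a1 a2] := pa e; have /andP[a'1 a'2] := pa' e.
have := ler_wpM2r (ltW Z'0) (aa' e).
have : 0 <= (a e * (1 - a' e)) * (Z - (1 - eps) * Z').
  by rewrite mulr_ge0 ?subr_ge0 // mulr_ge0 // subr_ge0.
lra.
Qed.

End Key.
End ClusterWeight.

(** * Finite-volume measures on the square lattice *)

Section FiniteVolumeExpect.
Import mathcomp.boot.fintype mathcomp.boot.fingraph mathcomp.boot.finset.
Variable G : subgraph.
Implicit Types (A : {set edges G}) (u v : sites G) (e : edges G).

Let srcP e : (val e).1 \in sites G.
Proof. by have /andP[] := edges_sites (valP e). Qed.

Let tgtP e : head_of (val e) \in sites G.
Proof. by have /andP[] := edges_sites (valP e). Qed.

Definition gsrc e : sites G := FSetSub (srcP e).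
Definition gtgt e : sites G := FSetSub (tgtP e).

Definition config_of A : config :=
  fun e : edge => if insub e is Some e' then e' \in A else false.

Definition wired_pair (xi : {set {set sites G}}) : rel (sites G) :=
  fun u v => [exists B in xi, (u \in B) && (v \in B)].

Lemma wired_pair_sym xi : symmetric (wired_pair xi).
Proof. by move=> u v; apply: eq_existsb => B; congr (_ && _); exact: andbC. Qed.

Lemma config_of_val A e : config_of A (val e) = (e \in A).
Proof. by rewrite /config_of valK. Qed.

Lemma config_of_notin A (e : edge) : e \notin edges G -> config_of A e = false.
Proof. by move=> eG; rewrite /config_of insubF //; apply/negbTE. Qed.

Lemma open_adj_config_of A u v :
  open_adj (config_of A) (val u) (val v) = [exists e in A, ends gsrc gtgt e u v].
Proof.
apply/idP/existsP; last first.
  move=> [e /andP[eA]]; rewrite /ends -!(inj_eq val_inj) /= => euv.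
  have oe : config_of A (val e) by rewrite config_of_val.
  rewrite /open_adj; case: e eA euv oe => -[y b] /= eG eA euv oe.
  by case/orP: euv => /andP[/eqP yu /eqP hv]; rewrite -yu -hv;
    case: b eG eA hv oe => eG eA hv oe; rewrite /head_of /= ?oe ?eqxx ?orbT.
have mk (y : site) b : config_of A (y, b) ->
    exists2 e : edges G, e \in A & val e = (y, b).
  move=> o; have yG : (y, b) \in edges G by apply: contraLR o => /config_of_notin->.
  by exists (FSetSub yG); rewrite // -config_of_val.
by rewrite /open_adj => /or4P[] /andP[/mk[e eA eE] /eqP hE]; exists e;
  rewrite eA /ends -!(inj_eq val_inj) /= eE /head_of /= hE !eqxx ?orbT.
Qed.

Lemma closed_extension_config_of (w : fconfig G) :
  closed_extension w = config_of [set e | w e].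
Proof.
by apply/funext => e; rewrite /closed_extension /config_of; case: insub => // e'; rewrite inE.
Qed.

Variables (R : realType) (p q : R) (xi : {set {set sites G}}).

Lemma num_clusters_cluster A :
  num_clusters xi [ffun e => e \in A] = #|clusters (wired_pair xi) gsrc gtgt A|.
Proof.
rewrite -card_clusters; last exact: wired_pair_sym.
apply: eq_n_comp => u v; congr (connect _ u v); apply/funext => x; apply/funext => y.
rewrite /wired_adj orbC closed_extension_config_of open_adj_config_of; congr (_ || _).
by apply: eq_existsb => e; rewrite inE ffunE.
Qed.

Lemma rc_weight_bern A :
  rc_weight p q xi [ffun e => e \in A] =
  bern_weight (fun=> p) A * cweight (wired_pair xi) gsrc gtgt q A.
Proof.
rewrite /rc_weight num_clusters_cluster; congr (_ * _).
rewrite /bern_weight (bigID (mem A)) /=; congr (_ * _).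
  rewrite (eq_bigr (fun=> p)) => [|e ->//]; rewrite prodr_const /num_open.
  by congr (_ ^+ _); apply: eq_card => e; rewrite !inE ffunE.
rewrite (eq_bigr (fun=> 1 - p)) => [|e /negbTE->//]; rewrite prodr_const /num_closed.
by congr (_ ^+ _); apply: eq_card => e; rewrite !inE ffunE.
Qed.

Lemma sum_fconfig (F : fconfig G -> R) :
  \sum_w F w = \sum_(A : {set edges G}) F [ffun e => e \in A].
Proof.
rewrite (reindex (fun A : {set edges G} => [ffun e => e \in A] : fconfig G)) //.
exists (fun w : fconfig G => [set e | w e]) => [A _|w _].
  by apply/setP => e; rewrite inE ffunE.
by apply/ffunP => e; rewrite ffunE inE.
Qed.

Lemma rc_expectationE (f : config -> R) :
  rc_expectation p q xi f =
  expect (cweight (wired_pair xi) gsrc gtgt q) (fun=> p) (fun A => f (config_of A)).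
Proof.
rewrite /rc_expectation /rc_prob /expect.
rewrite (_ : rc_partition_function p q xi = bern (fun=> p) (cweight (wired_pair xi) gsrc gtgt q)).
  rewrite sum_fconfig /bern big_distrl; apply: eq_bigr => A _ /=.
  rewrite rc_weight_bern closed_extension_config_of -!mulrA; congr (_ * (_ * _)).
  rewrite mulrC; congr (f _ * _); congr config_of; apply/setP => e.
  by rewrite inE ffunE.
rewrite /rc_partition_function sum_fconfig; apply: eq_bigr => A _.
exact: rc_weight_bern.
Qed.

End FiniteVolumeExpect.

(** * Translations of the lattice *)

Definition shift (z x : site) : site := (x.1 + z.1, x.2 + z.2).
Definition shift_edge (z : site) (e : edge) : edge := (shift z e.1, e.2).

Definition config_le (w w' : config) := forall e, w e -> w' e.

Definition depends_on (S : {fset edge}) T (f : config -> T) :=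
  forall w w' : config, (forall e, e \in S -> w e = w' e) -> f w = f w'.

Definition induced (G : subgraph) := forall e : edge,
  (e \in edges G) = (e.1 \in sites G) && (head_of e \in sites G).

Lemma shiftK z x : shift (- z.1, - z.2) (shift z x) = x.
Proof. by case: x => a b; rewrite /shift /= !addrK. Qed.

Lemma shiftNK z x : shift z (shift (- z.1, - z.2) x) = x.
Proof. by case: x => a b; rewrite /shift /= !addrNK. Qed.

Lemma shift_head z e : head_of (shift_edge z e) = shift z (head_of e).
Proof.
case: e => -[a b] [] /=; rewrite /head_of /shift_edge /shift /north /east /=; congr (_, _); ring.
Qed.

Lemma nbrs_head (e : edge) : head_of e \in lattice_nbrs e.1 /\ e.1 \in lattice_nbrs (head_of e).
Proof.
case: e => -[a b] [];
by rewrite /head_of /lattice_nbrs /north /east /west /south /= !inE ?addrK ?eqxx ?orbT.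
Qed.

Lemma nbrs_shift z x y : (shift z y \in lattice_nbrs (shift z x)) = (y \in lattice_nbrs x).
Proof.
have sI : injective (shift z) by move=> u v /(congr1 (shift (- z.1, - z.2))); rewrite !shiftK.
have -> : lattice_nbrs (shift z x) = map (shift z) (lattice_nbrs x).
  rewrite /lattice_nbrs /= /shift /north /east /west /south /=.
  by congr [:: (_, _); (_, _); (_, _); (_, _)]; ring.
by rewrite mem_map.
Qed.

(** * Monotonicity in the domain and in the boundary condition *)

Section DomainMonotonicity.
Import mathcomp.boot.fintype mathcomp.boot.fingraph mathcomp.boot.finset.
Variables (R : realType) (p q : R) (L G : subgraph) (z : site) (xi : {set {set sites G}}).
Hypotheses (p01 : 0 <= p <= 1) (q_ge1 : 1 <= q) (L_ind : induced L) (G_ind : induced G)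
  (xi_boundary : forall B, B \in xi -> B \subset boundary G)
  (LG : forall x, x \in sites L -> shift z x \in sites G)
  (b0 : sites L) (b0_boundary : b0 \in boundary L).

Let jP (e : edges L) : shift_edge z (val e) \in edges G.
Proof.
have := valP e; rewrite L_ind G_ind shift_head => /andP[h1 h2].
by rewrite /= !LG.
Qed.

Let j (e : edges L) : edges G := FSetSub (jP e).

Let jI : injective j.
Proof.
move=> e e' /(congr1 val) ee; apply: val_inj.
have /= e1 := congr1 (fun x : edge => shift (- z.1, - z.2) x.1) ee.
have /= e2 := congr1 snd ee.
by move: e1 e2; rewrite !shiftK; case: (val e) => ? ?; case: (val e') => ? ? /= -> ->.
Qed.

Let retract (u : sites G) : sites L := insubd b0 (shift (- z.1, - z.2) (val u)).

Let wiredL := wired_pair [set boundary L].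

Local Notation wL := (cweight wiredL (@gsrc L) (@gtgt L) q).

Let wiredL_boundary u v : wiredL u v = (u \in boundary L) && (v \in boundary L).
Proof.
apply/existsP/idP => [[B]|uv]; first by rewrite inE => /andP[/eqP->].
by exists (boundary L); rewrite inE eqxx.
Qed.

Let boundaryP (H : subgraph) (u : sites H) y :
  y \in lattice_nbrs (val u) -> y \notin sites H -> u \in boundary H.
Proof. by move=> yu yH; rewrite inE; apply/hasP; exists y. Qed.

Let retract_in (u : sites G) : shift (- z.1, - z.2) (val u) \in sites L ->
  shift z (val (retract u)) = val u.
Proof. by move=> uL; rewrite /retract insubdK // shiftNK. Qed.

Let retract_out (u : sites G) : shift (- z.1, - z.2) (val u) \notin sites L ->
  retract u = b0.
Proof. by move=> uL; rewrite /retract /insubd insubN. Qed.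

(** If [u] lies in the translate, [y] moved back is a neighbour outside [L]; if not, the image of
    [u] is [b0]. *)
Let retract_boundary (u : sites G) y : y \in lattice_nbrs (val u) ->
  (y \notin sites G) || (shift (- z.1, - z.2) y \notin sites L) -> retract u \in boundary L.
Proof.
move=> yu yout; case: (boolP (shift (- z.1, - z.2) (val u) \in sites L)) => uL.
  apply: (@boundaryP _ _ (shift (- z.1, - z.2) y)).
    by rewrite -(nbrs_shift z) retract_in // shiftNK.
  by case/orP: yout => // yG; apply: contraNN yG => /LG; rewrite shiftNK.
by rewrite retract_out.
Qed.

Let connL (B : {set edges G}) := connect (wadj wiredL (@gsrc L) (@gtgt L) [set e | j e \in B]).

(** A step of the path is either an edge of the translate of [L], or a wiring, or an edge with an
    end outside the translate. In the last two cases both images are boundary sites of [L], which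
    are wired together. *)
Let connect_retract (B : {set edges G}) u v :
  connect (wadj (wired_pair xi) (@gsrc G) (@gtgt G) B) u v -> connL B (retract u) (retract v).
Proof.
move=> /connectP[s]; elim: s u => [|u' s IH] u /=; first by move=> _ ->; apply: connect0.
move=> /andP[uu' us] vE; apply: connect_trans (IH _ us vE); apply: connect1.
have bb : retract u \in boundary L -> retract u' \in boundary L ->
    wadj wiredL (@gsrc L) (@gtgt L) [set e | j e \in B] (retract u) (retract u').
  by move=> h1 h2; rewrite /wadj wiredL_boundary h1 h2.
case/orP: uu' => [/existsP[C /and3P[Cxi uC u'C]]|/existsP[e /andP[eB euu']]].
  have bd x : x \in C -> retract x \in boundary L.
    move=> /(subsetP (xi_boundary Cxi)); rewrite inE => /hasP[y yx yG].
    by apply: retract_boundary yx _; apply/orP; left.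
  by apply: bb; apply: bd.
have [nb1 nb2] := nbrs_head (val e).
have [nuu' nu'u] : val u' \in lattice_nbrs (val u) /\ val u \in lattice_nbrs (val u').
  by case/orP: euu' => /andP[/eqP<- /eqP<-].
case: (boolP (shift (- z.1, - z.2) (val u) \in sites L)) => uL; last first.
  by apply: bb; [rewrite retract_out|apply: retract_boundary nu'u _; rewrite uL orbT].
case: (boolP (shift (- z.1, - z.2) (val u') \in sites L)) => u'L; last first.
  by apply: bb; [apply: retract_boundary nuu' _; rewrite u'L orbT|rewrite retract_out].
have eL : shift_edge (- z.1, - z.2) (val e) \in edges L.
  rewrite L_ind shift_head /=.
  by case/orP: euu' => /andP[/eqP su /eqP tu]; move: uL u'L; rewrite -su -tu => -> ->.
have je : j (FSetSub eL) = e.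
  apply: val_inj => /=; rewrite /shift_edge /= shiftNK; by case: (val e).
apply/orP; right; apply/existsP; exists (FSetSub eL); rewrite inE je eB /=.
by case/orP: euu' => /andP[/eqP su /eqP tu]; apply/orP; [left|right];
  rewrite -!(inj_eq val_inj) /= shift_head -su -tu /retract !insubdK ?eqxx // ?su ?tu.
Qed.

(* The translate of L sits inside G. Collapsing everything outside it to one boundary site
   maps connections in G under xi to connections in L under wired boundary conditions. *)
Lemma rc_expectation_le (f : config -> R) :
  (forall w w', config_le w w' -> f w <= f w') -> depends_on (edges L) f ->
  rc_expectation p q xi (fun w => f (w \o shift_edge z))
    <= rc_expectation p q [set boundary L] f.
Proof.
move=> f_inc f_loc; rewrite !rc_expectationE.
have pp (H : subgraph) : params (fun _ : edges H => p) by [].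
(* The wired weight of [L] is lifted to the edge sets of [G], ignoring the edges outside the
   translate, so that both measures live on the same space. *)
pose w2 (B : {set edges G}) : R := wL [set e | j e \in B].
pose clL (B : {set edges G}) := cluster wiredL (@gsrc L) (@gtgt L) [set e | j e \in B].
have sL := wired_pair_sym [set boundary L].
have sG := wired_pair_sym xi.
have q0 : 0 < q := lt_le_trans ltr01 q_ge1.
have -> : expect wL (fun=> p) (fun A => f (config_of A)) =
    expect w2 (fun=> p) (fun B => f (config_of [set e | j e \in B])).
  rewrite /expect /w2 (bern_preim (fun=> p) (fun A => wL A * f (config_of A)) jI).
  by rewrite (bern_preim (fun=> p) wL jI).
have -> : (fun B : {set edges G} => f (config_of [set e | j e \in B])) =
    (fun B => f (config_of B \o shift_edge z)).
  apply/funext => B; apply: f_loc => e eL.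
  rewrite -[e]/(val (FSetSub eL)) config_of_val inE /=.
  by rewrite -[shift_edge z e]/(val (j (FSetSub eL))) config_of_val.
have w2_add (B : {set edges G}) e : w2 (e |: B) = w2 B *
    (if [exists e0, (j e0 == e) && (gtgt e0 \notin clL B (gsrc e0))] then q^-1 else 1).
  rewrite /w2; case: (pickP (fun e0 => j e0 == e)) => [e0 /eqP je|none]; last first.
    rewrite (_ : [set e' | j e' \in e |: B] = [set e' | j e' \in B]); last first.
      by apply/setP => e'; rewrite !inE none.
    case: existsP => [[e']|_]; last by rewrite mulr1.
    by rewrite none.
  have -> : [set e' | j e' \in e |: B] = e0 |: [set e' | j e' \in B].
    by apply/setP => e'; rewrite !inE -je (inj_eq jI).
  rewrite (cweight_add sL q_ge1 _ (ends_src_tgt _ _ _)); congr (_ * _).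
  case: existsP => [[e' /andP[/eqP je']]|none].
    have -> : e' = e0 by apply: jI; rewrite je je'.
    by move/negbTE->.
  by case: ifPn => // nc; case: none; exists e0; rewrite je eqxx.
apply: expect_mono => //.
- by move=> A; apply: cweight_gt0.
- by move=> A; apply: cweight_gt0.
- exact: cweight_dominated.
- move=> A B e AB _; rewrite w2_add (cweight_add sG q_ge1 _ (ends_src_tgt _ _ e)).
  set c := if _ then _ else _; set d := if _ then _ else _.
  suff cd : c <= d.
    have wA := ltW (cweight_gt0 (wired_pair xi) (@gsrc G) (@gtgt G) q_ge1 A).
    have wB := ltW (cweight_gt0 wiredL (@gsrc L) (@gtgt L) q_ge1 [set e | j e \in B]).
    by have := ler_wpM2l (mulr_ge0 wA wB) cd; rewrite -/(w2 B); lra.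
  have qV : q^-1 <= 1 by rewrite invf_le1.
  (* Off the translate the factor of [w2] is 1. On it, ends connected in [G] are connected in [L] by
     [connect_retract]. *)
  rewrite /c /d; case: existsP => [[e0 /andP[/eqP je]]|_]; last by case: ifP.
  case: ifP => // /(subsetP (cluster_mono _ _ _ _ AB)).
  rewrite !inE => /connect_retract; rewrite /connL -je.
  have -> : retract (gsrc (j e0)) = gsrc e0.
    by apply: val_inj; rewrite /retract insubdK /= shiftK //; exact: (valP (gsrc e0)).
  have -> : retract (gtgt (j e0)) = gtgt e0.
    by apply: val_inj; rewrite /retract insubdK /= shift_head shiftK //; exact: (valP (gtgt e0)).
  by move=> ->.
- move=> A B AB; apply: f_inc => e; rewrite /= /config_of.
  by case: insub => // e'; apply: (subsetP AB).
Qed.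

End DomainMonotonicity.

(** * Boxes and the sup-norm *)

Definition nrm (x : site) : nat := maxn `|x.1|%N `|x.2|%N.

Definition origin : site := (0, 0).

Definition int_range (N : nat) : seq int := [seq i%:Z - N%:Z | i <- iota 0 (2 * N).+1].

Lemma mem_int_range N (a : int) : (a \in int_range N) = (`|a|%N <= N)%N.
Proof.
apply/mapP/idP => [[i]|aN].
  by rewrite mem_iota => ? ->; lia.
by exists (absz (a + N%:Z)); [rewrite mem_iota; lia|lia].
Qed.

Definition box_sites (N : nat) : {fset site} :=
  seq_fset tt [seq (a, b) | a <- int_range N, b <- int_range N].

Lemma mem_box_sites N x : (x \in box_sites N) = (nrm x <= N)%N.
Proof.
rewrite seq_fsetE geq_max -!mem_int_range.
apply/allpairsP/andP => [[[c d] [? ? ->]]//|[x1 x2]].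
by exists x; split=> //; case: x x1 x2.
Qed.

Definition box_edges (N : nat) : {fset edge} :=
  seq_fset tt [seq e : edge <- [seq (x, b) | x <- enum_fset (box_sites N), b <- [:: true; false]]
              | head_of e \in box_sites N].

Lemma mem_box_edges N (e : edge) :
  (e \in box_edges N) = (e.1 \in box_sites N) && (head_of e \in box_sites N).
Proof.
rewrite seq_fsetE mem_filter andbC; congr (_ && _);
apply/allpairsP/idP => [[[y c] [? ? ->]]//|xN].
by exists e; split=> //; [case: (e.2)|case: e xN].
Qed.

Lemma box_edges_sites N e : e \in box_edges N ->
  (e.1 \in box_sites N) && (head_of e \in box_sites N).
Proof. by rewrite mem_box_edges. Qed.

Definition box (N : nat) : subgraph := Subgraph (@box_edges_sites N).

Lemma mem_box N x : (x \in sites (box N)) = (nrm x <= N)%N.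
Proof. exact: mem_box_sites. Qed.

Lemma box_induced N : induced (box N).
Proof. exact: mem_box_edges. Qed.

Lemma box_is_box N : is_box (box N).
Proof.
exists (- N%:Z, - N%:Z), (N%:Z, N%:Z); split=> [x|e]; last exact: box_induced.
by rewrite mem_box /nrm /=; lia.
Qed.

Lemma boxes_exhaust : boxes_to_lattice box.
Proof.
split=> [N|N|x]; first exact: box_is_box.
  by apply/fsubsetP => x; rewrite !mem_box => /leqW.
by exists (nrm x); rewrite mem_box.
Qed.

Lemma nrm_east N : nrm (N%:Z, 0) = N.
Proof. by rewrite /nrm /=; lia. Qed.

Lemma box_corner_subproof N : (N%:Z, 0) \in sites (box N).
Proof. by rewrite mem_box nrm_east. Qed.

(** A boundary site of the box: the exterior is collapsed onto it, and its existence makes the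
    single wired block a legitimate partition. *)
Definition box_corner N : sites (box N) := FSetSub (box_corner_subproof N).

Lemma box_corner_boundary N : box_corner N \in boundary (box N).
Proof.
rewrite inE; apply/hasP; exists (east (N%:Z, 0)); first by rewrite /= inE eqxx.
by rewrite /= mem_box /nrm /east /=; lia.
Qed.

Lemma nbrs_nrm x y : y \in lattice_nbrs x -> (nrm y <= (nrm x).+1)%N.
Proof.
by rewrite !inE => /or4P[]/eqP->; rewrite /nrm /east /west /north /south /=; lia.
Qed.

Lemma interior_box N (u : sites (box N)) : (nrm (val u) < N)%N -> u \notin boundary (box N).
Proof.
move=> uN; rewrite inE; apply/hasPn => y /nbrs_nrm yu; rewrite /= mem_box negbK.
exact: leq_trans yu uN.
Qed.

Lemma open_adj_nbrs w x y : open_adj w x y -> y \in lattice_nbrs x.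
Proof.
by move=> /or4P[]/andP[_ /eqP->];
  rewrite !inE /east /west /north /south /= ?addrK -?surjective_pairing ?eqxx ?orbT.
Qed.

Lemma open_adj_local (N : nat) w w' x y : (forall e, e \in edges (box N) -> w e = w' e) ->
  (nrm x < N)%N -> open_adj w x y -> open_adj w' x y.
Proof.
move=> ww' xN xy; have yN := leq_trans (nbrs_nrm (open_adj_nbrs xy)) xN.
have xN' := ltnW xN.
by case/or4P: xy => /andP[h /eqP yE]; apply/or4P; [apply: Or41|apply: Or42|apply: Or43|apply: Or44];
  rewrite -ww' ?h ?yE ?eqxx //= mem_box_edges /head_of /= !mem_box_sites -?yE ?xN' ?yN.
Qed.

(** * Exit of the cluster of the origin from a ball *)

Definition exits (r : nat) : set config :=
  [set w | exists z, joined w origin z /\ (r < nrm z)%N].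

Lemma exits_inc r w w' : config_le w w' -> exits r w -> exits r w'.
Proof.
move=> ww' [z [[s [sp sz]] rz]]; exists z; split=> //; exists s; split=> //.
apply: sub_path sp => x y; rewrite /open_adj => /or4P[]/andP[/ww'-> ->];
by rewrite ?orbT.
Qed.

Lemma joined_cons w x y z : open_adj w x y -> joined w y z -> joined w x z.
Proof. by move=> xy [s [sp sz]]; exists (y :: s); rewrite /= xy. Qed.

Lemma joined_refl w x : joined w x x.
Proof. by exists [::]. Qed.

(** Only the steps up to the first site beyond distance [r] matter. They start at distance at most
    [r], hence use edges of the box of radius [N]. *)
Lemma exits_local r (N : nat) w w' : (r < N)%N -> (forall e, e \in edges (box N) -> w e = w' e) ->
  exits r w -> exits r w'.
Proof.
move=> rN ww' [_ [[s [sp <-]]]].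
have : (nrm origin <= r)%N by [].
rewrite /exits /=; elim: s (origin) sp => [|y s IH] x /=; first by move=> _ xr; rewrite ltnNge xr.
move=> /andP[xy sp] xr rl; have xN := leq_ltn_trans xr rN.
have xy' := open_adj_local ww' xN xy.
case: (leqP (nrm y) r) => yr; last first.
  by exists y; split=> //; exact: joined_cons xy' (joined_refl _ _).
have [z [yz rz]] := IH y sp yr rl.
by exists z; split=> //; exact: joined_cons xy' yz.
Qed.

Lemma exits_depends r N T (f : bool -> T) : (r < N)%N ->
  depends_on (edges (box N)) (fun w => f (w \in exits r)).
Proof.
move=> rN w w' ww'; congr f; apply/idP/idP => /set_mem ew; apply/mem_set.
  exact: (exits_local rN ww' ew).
by apply: (exits_local rN _ ew) => e eN; rewrite ww'.
Qed.

Lemma open_adj_shift w z x y :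
  open_adj (w \o shift_edge z) x y = open_adj w (shift z x) (shift z y).
Proof.
have sI : injective (shift z) by move=> u v /(congr1 (shift (- z.1, - z.2))); rewrite !shiftK.
have sh_e u : shift z (east u) = east (shift z u) by rewrite /shift /east /=; congr (_, _); ring.
have sh_n u : shift z (north u) = north (shift z u) by rewrite /shift /north /=; congr (_, _); ring.
by rewrite /open_adj /= /shift_edge /= -!sh_e -!sh_n !(inj_eq sI).
Qed.

Lemma joined_shift w z x y : joined w (shift z x) (shift z y) -> joined (w \o shift_edge z) x y.
Proof.
move=> [s [sp sy]]; exists [seq shift (- z.1, - z.2) u | u <- s].
elim: s x sp sy => [|u s IH] x /=.
  by move=> _ /(congr1 (shift (- z.1, - z.2))); rewrite !shiftK.
move=> /andP[xu us] sy; rewrite open_adj_shift shiftNK xu /=.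
by apply: IH; rewrite shiftNK.
Qed.

Definition dist (x y : site) : nat := nrm (shift (- y.1, - y.2) x).

Lemma exits_dist r w x z : joined w x z -> (r < dist z x)%N ->
  exits r (w \o shift_edge x).
Proof.
move=> xz rz; exists (shift (- x.1, - x.2) z); split=> //.
have -> : origin = shift (- x.1, - x.2) x by rewrite /shift /= !subrr.
by apply: joined_shift; rewrite !shiftNK.
Qed.

(** Discrete intermediate values: the sup-norm grows by at most 1 along a lattice edge. *)
Lemma joined_norm w x s j : path (open_adj w) x s -> (nrm x <= j <= nrm (last x s))%N ->
  exists2 y, joined w x y & nrm y = j.
Proof.
elim: s x => [|y s IH] x /=.
  by move=> _ xj; exists x; [exact: joined_refl|lia].
move=> /andP[xy ys] /andP[xj jl]; case: (ltngtP (nrm x) j) xj => // [xj _|xj _]; last first.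
  by exists x; [exact: joined_refl|].
have yj : (nrm y <= j)%N := leq_trans (nbrs_nrm (open_adj_nbrs xy)) xj.
have [|z yz zj] := IH y ys; first by rewrite yj.
by exists z => //; exact: joined_cons xy yz.
Qed.

Lemma nrm_shift x y : (nrm (shift x y) <= nrm x + nrm y)%N.
Proof. by rewrite /nrm /shift /=; lia. Qed.

Lemma nrm_dist x y : (nrm x <= dist x y + nrm y)%N.
Proof. by rewrite /dist /nrm /shift /=; lia. Qed.

Lemma distC x y : dist x y = dist y x.
Proof. by rewrite /dist /nrm /shift /=; lia. Qed.

(** * Exponential decay in wired boxes *)

Section BoxBound.
Import mathcomp.boot.fintype mathcomp.boot.fingraph mathcomp.boot.finset.
Variables (R : realType) (q : R).
Hypothesis q_ge1 : 1 <= q.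

Definition wired_box (N : nat) : {set {set sites (box N)}} := [set boundary (box N)].

Definition exit_prob (p : R) (N r : nat) : R :=
  rc_expectation p q (wired_box N) (fun w => (w \in exits r)%:R).

Lemma exit_prob_ge (p : R) (N r : nat) (G : subgraph) (xi : {set {set sites G}}) (y : site) :
  0 <= p <= 1 -> (r < N)%N -> induced G ->
  (forall B, B \in xi -> B \subset boundary G) ->
  (forall x, (nrm x <= N)%N -> shift y x \in sites G) ->
  rc_expectation p q xi (fun w => (w \o shift_edge y \in exits r)%:R) <= exit_prob p N r.
Proof.
move=> p01 rN Gi xib NG.
apply: (@rc_expectation_le R p q (box N) G y xi p01 q_ge1 (@box_induced N) Gi xib _
  (box_corner N) (box_corner_boundary N) (fun w => (w \in exits r)%:R)).
- by move=> x; rewrite mem_box; apply: NG.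
- move=> w w' ww'; case: (boolP (w \in exits r)) => [/set_mem ew|_]; last by rewrite ler0n.
  by rewrite mem_set //; apply: exits_inc ew.
- exact: (@exits_depends r N R (fun b => b%:R) rN).
Qed.

Section Box.
Variable M : nat.
Local Notation V := (sites (box M)).
Local Notation adj := (wadj (wired_pair (wired_box M)) (@gsrc (box M)) (@gtgt (box M))).
Local Notation cl := (cluster (wired_pair (wired_box M)) (@gsrc (box M)) (@gtgt (box M))).

Lemma wired_box_pair u v : wired_pair (wired_box M) u v ->
  (u \in boundary (box M)) && (v \in boundary (box M)).
Proof. by move=> /existsP[B]; rewrite inE => /andP[/eqP->]. Qed.

(** Clusters allow wiring steps, whereas [exits] allows open edges only. Until it first gets further
    than [r] from [u], the path stays in the interior of the box, where no wiring step is
    possible. *)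
Lemma cluster_exits A (u v : V) r : (nrm (val u) + r < M)%N -> v \in cl A u ->
  (r < dist (val v) (val u))%N -> exits r (config_of A \o shift_edge (val u)).
Proof.
move=> uM; rewrite inE => /connectP[s]; move: (v) => {}v.
suff main x : (dist (val x) (val u) <= r)%N -> path (adj A) x s ->
    (r < dist (val (last x s)) (val u))%N ->
    exists2 z, joined (config_of A) (val x) z & (r < dist z (val u))%N.
  move=> us -> rl; have [|z uz rz] := main u _ us rl; last exact: exits_dist uz rz.
  by rewrite /dist /shift /nrm /= !subrr.
elim: s x => [|y s IH] x xr /=; first by rewrite ltnNge xr.
move=> /andP[xy ys] rl.
have xo : open_adj (config_of A) (val x) (val y).
  rewrite open_adj_config_of; case/orP: xy => // /wired_box_pair/andP[xb _].
  suff : x \notin boundary (box M) by rewrite xb.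
  apply: interior_box; apply: leq_ltn_trans (nrm_dist (val x) (val u)) _.
  by apply: leq_ltn_trans uM; rewrite addnC leq_add2l.
case: (leqP (dist (val y) (val u)) r) => yr; last first.
  by exists (val y) => //; exact: joined_cons xo (joined_refl _ _).
have [z yz rz] := IH y yr ys rl.
by exists z => //; exact: joined_cons xo yz.
Qed.

Lemma joined_cluster A (u : V) z : joined (config_of A) (val u) z ->
  exists2 v : V, val v = z & v \in cl A u.
Proof.
move=> [s [sp <-]]; elim: s u sp => [|y s IH] u /=; first by exists u => //; exact: mem_cluster.
move=> /andP[uy ys].
have yM : y \in sites (box M).
  have edgeM e : config_of A e -> e \in edges (box M).
    by apply: contraLR => /config_of_notin->.
  by case/or4P: uy => /andP[/edgeM /edges_sites/andP[/= h1 h2] /eqP] => [yE|yE|_|_];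
    rewrite ?yE.
have [v vE vy] := IH (FSetSub yM) ys; exists v => //.
rewrite inE in vy; rewrite inE; apply: connect_trans vy; apply: connect1.
by rewrite /wadj -open_adj_config_of uy orbT.
Qed.

Definition levels (n : nat) (X : {set V}) : {set 'I_n} :=
  [set j : 'I_n | [exists z in X, nrm (val z) == j]].

Lemma levels_mono n (X Y : {set V}) : X \subset Y -> levels n X \subset levels n Y.
Proof.
move=> /subsetP XY; apply/subsetP => i; rewrite !inE => /existsP[z /andP[/XY zY zi]].
by apply/existsP; exists z; rewrite zY.
Qed.

Lemma levelsU n (X Y : {set V}) : levels n (X :|: Y) = levels n X :|: levels n Y.
Proof.
apply/setP => i; rewrite !inE; apply/existsP/orP => [[z]|].
  by rewrite inE => /andP[/orP[] zX zi]; [left|right]; apply/existsP; exists z; rewrite zX.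
by case=> /existsP[z /andP[zX zi]]; exists z; rewrite inE zX zi ?orbT.
Qed.

(** The norm is 1-Lipschitz for [dist], so the levels met lie in a window of length [2 * r + 1]; the
    truncation of the subtraction at 0 is harmless. *)
Lemma levels_ball n (X : {set V}) (y : V) r :
  (forall z, z \in X -> (dist (val z) (val y) <= r)%N) -> (#|levels n X| <= 2 * r + 1)%N.
Proof.
move=> Xr; apply: (@leq_trans (size (iota (nrm (val y) - r) (2 * r + 1)))).
  rewrite cardE -(size_map val); apply: uniq_leq_size.
    by rewrite (map_inj_uniq val_inj) enum_uniq.
  move=> i /mapP[k]; rewrite mem_enum inE => /existsP[z /andP[/Xr zr /eqP zk]] ->.
  rewrite /= mem_iota -zk; move: (nrm_dist (val z) (val y)) (nrm_dist (val y) (val z)) zr.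
  rewrite (distC (val y)); move: (nrm _) (nrm _) (dist _ _) => a b d; lia.
by rewrite size_iota.
Qed.

Lemma levels_far n (X : {set V}) : (forall z, z \in X -> (n <= nrm (val z))%N) ->
  #|levels n X| = 0%N.
Proof.
move=> Xn; apply/eqP; rewrite cards_eq0; apply/eqP/setP => i; rewrite !inE.
by apply/negbTE/negP => /existsP[z /andP[/Xn nz /eqP zi]]; move: nz; rewrite zi leqNgt ltn_ord.
Qed.

Local Notation cw := (cweight (wired_pair (wired_box M)) (@gsrc (box M)) (@gtgt (box M)) q).

Let pair_sym := wired_pair_sym (wired_box M).

Let cw_gt0 A : 0 < cw A.
Proof. exact: cweight_gt0. Qed.

Lemma card_levels_le n (X : {set V}) : (#|levels n X| <= n)%N.
Proof. by rewrite -[leqRHS](card_ord n) max_card. Qed.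

Lemma exit_prob_tilt (p p' c eps : R) n : 0 <= p <= 1 -> 0 <= p' <= 1 -> 0 < c <= 1 ->
  0 <= eps < 1 -> p' * (1 - p) <= (1 - eps) * (p * (1 - p')) ->
  (forall y : V, 1 - eps <= expect cw (fun=> p) (fun A => c ^+ #|levels n (cl A y)|)) ->
  exit_prob p' M n <= c ^+ n / (1 - eps).
Proof.
move=> p01 p'01 /andP[c0 c1] /andP[e0 e1] odds small.
have oM : origin \in sites (box M) by rewrite mem_box.
pose o : V := FSetSub oM.
(* On the event that all [n] levels are met the tilt equals [c ^+ n]. By [small] at the origin, the
   tilted partition function is at least [1 - eps] times the untilted one. *)
pose F (X : {set V}) : R := (#|levels n X| == n)%:R.
have incF (X Y : {set V}) : X \subset Y -> F X <= F Y.
  move=> /(levels_mono n)/subset_leq_card XY; rewrite /F ler_nat.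
  case: eqP => // Xn; rewrite Xn in XY; rewrite eqn_leq XY card_levels_le //.
have pp : params (fun _ : edges (box M) => p) by [].
have pp' : params (fun _ : edges (box M) => p') by [].
pose g (X : {set V}) := c ^+ #|levels n X|.
have g0 X : 0 < g X by exact: exprn_gt0.
have ganti (X Y : {set V}) : X \subset Y -> g Y <= g X.
  by move=> /(levels_mono n)/subset_leq_card XY; apply: ler_wiXn2l => //; exact: ltW.
have gmul (X Y : {set V}) : g X * g Y <= g (X :|: Y).
  rewrite /g -exprD levelsU; apply: ler_wiXn2l => //; first exact: ltW.
  exact: leq_card_setU.
apply: (@le_trans _ _ (expect cw (fun=> p') (fun A => F (cl A o)))).
  rewrite /exit_prob rc_expectationE; apply: ler_expect => // A _; rewrite /F ler_nat.
  case: (boolP (_ \in exits n)) => // /set_mem[z [[s [sp sz]] nz]].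
  suff -> : levels n (cl A o) = [set: 'I_n] by rewrite cardsT card_ord eqxx.
  apply/setP => i; rewrite !inE; apply/existsP.
  have [|y oy yi] := joined_norm (j := i) sp.
    by rewrite sz /= (leq_trans (ltnW (ltn_ord i)) (ltnW nz)).
  have [v vE vo] := joined_cluster (u := o) oy.
  by exists v; rewrite vo vE yi eqxx.
have := expect_tilted pair_sym q_ge1 o (g := g) (eps := eps) (a0 := fun=> p) (a := fun=> p)
  g0 ganti gmul e0 (ltW e1) pp small pp pp' (fun=> lexx _) (fun=> odds) incF.
move=> /le_trans; apply.
have wg0 A : 0 < cw A * g (cl A o) by rewrite mulr_gt0.
rewrite /expect ler_pdivrMr ?bern_gt0 //.
apply: (@le_trans _ _ (c ^+ n * bern (fun=> p) cw)).
  rewrite -bernZ; apply: ler_bern => // A _; rewrite -mulrA mulrC ler_wpM2r ?(ltW (cw_gt0 _)) //.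
  rewrite /F /g; case: eqP => [->|_]; first by rewrite mulr1.
  by rewrite mulr0 exprn_ge0 ?ltW.
rewrite -mulrA ler_wpM2l ?exprn_ge0 ?(ltW c0) //.
rewrite ler_pdivlMl ?subr_gt0 // -ler_pdivlMr ?bern_gt0 //; exact: small o.
Qed.

(** Unless the cluster leaves the ball of radius [r] around [y], it meets at most [2 * r + 1]
    levels. *)
Lemma expect_cluster_close p c r n (y : V) : 0 <= p <= 1 -> 0 < c <= 1 ->
  (nrm (val y) + r < M)%N ->
  c ^+ (2 * r + 1) -
    rc_expectation p q (wired_box M) (fun w => (w \o shift_edge (val y) \in exits r)%:R)
  <= expect cw (fun=> p) (fun A => c ^+ #|levels n (cl A y)|).
Proof.
move=> p01 /andP[c0 c1] yM; have pp : params (fun _ : edges (box M) => p) by [].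
rewrite rc_expectationE -mulN1r -expectZ -{1}(expect_cst (c ^+ (2 * r + 1)) pp cw_gt0) -expectD.
apply: ler_expect => // A _; case: (boolP (_ \in _)) => [_|nex].
  apply: (@le_trans _ _ 0); last by rewrite exprn_ge0 // ltW.
  by rewrite mulr1 subr_le0 exprn_ile1 // ltW.
rewrite mulr0 addr0; apply: ler_wiXn2l => //; first exact: ltW.
apply: (@levels_ball n _ y) => z zy; rewrite leqNgt; apply: contra nex => rz.
by apply/mem_set; apply: cluster_exits rz.
Qed.

(** The tilt is 1 unless the cluster of [y] contains a site [z] at distance less than [n] from the
    origin. The exit event used is that of [z], which lies deep inside the box, so that wiring near
    [y] does no harm. *)
Lemma expect_cluster_far p c r n (y : V) : 0 <= p <= 1 -> 0 < c <= 1 ->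
  (n + r < M)%N -> (n + r < nrm (val y))%N ->
  1 - \sum_(z : sites (box n)) rc_expectation p q (wired_box M)
        (fun w => (w \o shift_edge (val z) \in exits r)%:R)
  <= expect cw (fun=> p) (fun A => c ^+ #|levels n (cl A y)|).
Proof.
move=> p01 /andP[c0 c1] nM ny; have pp : params (fun _ : edges (box M) => p) by [].
have -> : \sum_(z : sites (box n)) rc_expectation p q (wired_box M)
        (fun w => (w \o shift_edge (val z) \in exits r)%:R) =
    expect cw (fun=> p) (fun A => \sum_(z : sites (box n))
      (config_of A \o shift_edge (val z) \in exits r)%:R).
  under eq_bigr do rewrite rc_expectationE.
  rewrite /expect -big_distrl -bern_sum /=; congr (_ / _); apply: eq_bern => A _.
  by rewrite big_distrr.
rewrite -mulN1r -expectZ -{1}(expect_cst 1 pp cw_gt0) -expectD.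
apply: ler_expect => // A _.
pose near_origin (z : V) := (z \in cl A y) && (nrm (val z) < n)%N.
case: (pickP near_origin) => [z /andP[zy zn]|none]; last first.
  rewrite levels_far ?expr0; last first.
    by move=> z zy; rewrite leqNgt; have /negbT := none z; rewrite /near_origin zy.
  by rewrite mulN1r lerBlDr lerDl sumr_ge0.
have znb : val z \in sites (box n) by rewrite mem_box ltnW.
rewrite (bigD1 (FSetSub znb)) //= mem_set /=; last first.
  apply: (@cluster_exits A z y r).
  - by apply: leq_ltn_trans nM; rewrite leq_add2r ltnW.
  - by rewrite cluster_sym.
  - rewrite ltnNge; apply/negP => yr; have := nrm_dist (val y) (val z).
    by move: yr ny zn; move: (nrm _) (nrm _) (dist _ _) => a b d; lia.
rewrite mulN1r opprD addrA subrr add0r.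
apply: (@le_trans _ _ 0); last by rewrite exprn_ge0 // ltW.
by rewrite oppr_le0 sumr_ge0.
Qed.

End Box.

Lemma exit_prob_decay (p p' : R) : 0 <= p' < p -> p < 1 ->
  (forall d, 0 < d -> exists r N, (r < N)%N /\ exit_prob p N r <= d) ->
  exists c, 0 < c < 1 /\ forall n, exists M, (n < M)%N /\ exit_prob p' M n <= 2 * c ^+ n.
Proof.
(* Since [p * (1 - p') - p' * (1 - p) = p - p'], this value satisfies the odds condition; it is also
   below 1/2, so that [(1 - eps)^-1 <= 2]. *)
move=> /andP[p'0 p'p] p1 decay; pose eps := (p - p') / 2.
have eps0 : 0 < eps by rewrite divr_gt0 // subr_gt0.
have eps1 : eps < 1 / 2 by rewrite /eps; lra.
have p01 : 0 <= p <= 1 by lra.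
have p'01 : 0 <= p' <= 1 by lra.
have odds : p' * (1 - p) <= (1 - eps) * (p * (1 - p')).
  have : eps * (p * (1 - p')) <= eps.
    by apply: ler_piMr; [exact: ltW|apply: mulr_ile1; lra].
  rewrite /eps; lra.
clearbody eps.
have [r1 [N1 [rN1 small1]]] := decay (eps / 2) ltac:(by rewrite divr_gt0).
(* By Bernoulli's inequality [c ^+ k >= 1 - k * t = 1 - eps / 2]; the other half of [eps] pays for
   the exit probability at radius [r1]. Neither [r1] nor [c] depends on [n]. *)
pose k := (2 * r1 + 1)%N; pose t := eps / 2 / k%:R; pose c := 1 - t.
have k0 : (0 : R) < k%:R by rewrite ltr0n /k addn1.
have ek : t <= eps / 2.
  by rewrite /t ler_pdivrMr //; apply: ler_peMr; [rewrite divr_ge0 // ltW|rewrite ler1n /k addn1].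
have ek0 : 0 < t by rewrite /t !divr_gt0.
have c01 : 0 < c <= 1 by move: ek ek0; rewrite /c; move: (t) => ?; lra.
have ck : 1 - eps / 2 <= c ^+ k.
  have bern_ineq m (u : R) : 0 <= u <= 1 -> 1 - m%:R * u <= (1 - u) ^+ m.
    move=> u01; elim: m => [|m IH]; first by rewrite mul0r subr0 expr0.
    rewrite exprS; apply: le_trans (ler_wpM2l _ IH); last lra.
    have : 0 <= m%:R * (u * u) by rewrite mulr_ge0 // mulr_ge0 //; lra.
    rewrite -addn1 natrD; lra.
  have -> : eps / 2 = k%:R * t by rewrite /t [RHS]mulrC divfK // gt_eqF.
  by apply: bern_ineq; move: ek ek0; move: (t) => ?; lra.
exists c; split; first by move: ek ek0; rewrite /c; move: (t) => ?; lra.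
move=> n; pose s := #|{: sites (box n)}|.
have s0 : (0 : R) < s%:R.
  by rewrite ltr0n; apply/card_gt0P; exists (box_corner n).
(* This radius may depend on [n]: it only enters the union bound over the [s] sites of the box of
   radius [n], and not [c]. *)
have [r2 [N2 [rN2 small2]]] := decay (eps / s%:R) ltac:(by rewrite divr_gt0).
(* [M] leaves room for a box of radius [N1] around each site up to distance [n + r2], and for one of
   radius [N2] around each site of the box of radius [n]. Sites beyond [n + r2] are treated by the
   union bound. *)
have [M [nM N1M N2M]] : exists M, [/\ (n + r2 < M)%N, (n + r2 + N1 <= M)%N & (n + N2 <= M)%N].
  by exists (n + r2 + N1 + N2).+1; split; clear; lia.
exists M; split; first exact: leq_ltn_trans (leq_addr _ _) nM.
have bnd : c ^+ n / (1 - eps) <= 2 * c ^+ n.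
  rewrite mulrC ler_wpM2r ?exprn_ge0 //; first lra.
  by rewrite -[leRHS]invrK lef_pV2 ?posrE; lra.
apply: le_trans bnd; apply: (exit_prob_tilt p01 p'01 c01 _ odds); first lra.
move=> y; have [close|far] := leqP (nrm (val y)) (n + r2).
  have yM : (nrm (val y) + r1 < M)%N by apply: leq_trans N1M; rewrite -addnS leq_add.
  apply: le_trans (expect_cluster_close n p01 c01 yM).
  have : rc_expectation p q (wired_box M)
      (fun w => (w \o shift_edge (val y) \in exits r1)%:R) <= eps / 2.
    apply: le_trans small1; apply: exit_prob_ge => //; first exact: box_induced.
      by move=> B; rewrite inE => /eqP->.
    move=> x xN; rewrite mem_box; apply: leq_trans (nrm_shift _ _) _.
    by apply: leq_trans N1M; rewrite leq_add.
  by move: ck; rewrite /k; lra.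
apply: le_trans (expect_cluster_far p01 c01 nM far); rewrite lerD2l lerN2.
have -> : eps = \sum_(z : sites (box n)) eps / s%:R.
  by rewrite sumr_const -/s -[RHS]mulr_natr divfK // gt_eqF.
apply: ler_sum => z _; apply: le_trans small2; apply: exit_prob_ge => //; first exact: box_induced.
  by move=> B; rewrite inE => /eqP->.
move=> x xN; rewrite mem_box; apply: leq_trans (nrm_shift _ _) _.
have := valP z; rewrite mem_box /= => zn.
by apply: leq_trans N2M; rewrite leq_add.
Qed.

End BoxBound.

Local Open Scope classical_set_scope.
Local Open Scope ring_scope.

(** * Infinite-volume limits *)

Definition agree (N : nat) (w w' : config) := forall e, e \in edges (box N) -> w e = w' e.

Lemma agreeC N w w' : agree N w w' -> agree N w' w.
Proof. by move=> ww' e /ww'. Qed.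

Lemma agree_trans N w1 w2 w3 : agree N w1 w2 -> agree N w2 w3 -> agree N w1 w3.
Proof. by move=> w12 w23 e eN; rewrite w12 ?w23. Qed.

Lemma box_edges_mono M N : (M <= N)%N -> forall e, e \in edges (box M) -> e \in edges (box N).
Proof.
move=> MN e; rewrite !box_induced !mem_box => /andP[e1 e2].
by rewrite !(leq_trans _ MN).
Qed.

Lemma agree_leq M N w w' : (M <= N)%N -> agree N w w' -> agree M w w'.
Proof. by move=> MN ww' e /(box_edges_mono MN)/ww'. Qed.

Lemma edge_in_box (e : edge) : exists N, e \in edges (box N).
Proof.
exists (nrm e.1).+1; rewrite box_induced !mem_box leqnSn /=.
exact/nbrs_nrm/(nbrs_head e).1.
Qed.

Lemma config_proj_continuous (e : edge) : continuous (fun w : config => w e).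
Proof. exact: (@proj_continuous edge (fun=> bool) e). Qed.

Lemma agree_nbhs N (w : config) : nbhs w [set w' | agree N w w'].
Proof.
have h : nbhs w (\bigcap_(e in [set` edges (box N)]) [set w' : config | w e = w' e]).
  apply: filter_bigI => e _.
  have : nbhs (w e) [set b | w e = b] by [].
  by move=> /(@config_proj_continuous e w).
by apply: filterS h => w' /= ww' e /ww'.
Qed.

(** The filter generated by the sets [agree N w] converges to [w] in each coordinate, hence in the
    product topology. *)
Lemma nbhs_agree (w : config) (U : set config) : nbhs w U ->
  exists N, [set w' | agree N w w'] `<=` U.
Proof.
pose F : set_system config := filter_from setT (fun N => [set w' | agree N w w']).
have FF : Filter F.
  apply: filter_from_filter; first by exists 0%N.
  move=> M N _ _; exists (maxn M N) => // w' ww'.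
  by split; apply: agree_leq ww'; rewrite ?leq_maxl ?leq_maxr.
have Fw : F --> w.
  apply/cvg_sup => e; apply/cvg_image => //.
    by apply/seteqP; split=> // b _; exists (fun=> b).
  move=> B /nbhs_singleton Bwe; have [N eN] := edge_in_box e.
  exists [set w' | B (w' e)].
    by exists N => // w' ww' /=; rewrite -(ww' e eN).
  by apply/seteqP; split=> [_ [w' Bw' <-]//|b Bb]; exists (fun=> b).
by move=> /Fw[N _ NU]; exists N.
Qed.

Lemma config_compact : compact [set: config].
Proof.
have := @tychonoff edge (fun=> bool) (fun=> setT) (fun=> bool_compact).
by congr compact; rewrite eqEsubset; split.
Qed.

Definition cylindrical (N : nat) T (f : config -> T) := forall w w', agree N w w' -> f w = f w'.

Lemma cylindrical_leq M N T (f : config -> T) : (M <= N)%N -> cylindrical M f -> cylindrical N f.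
Proof. by move=> MN fM w w' /(agree_leq MN)/fM. Qed.

(** Uniform continuity, from the compactness of the configuration space. *)
Lemma continuous_cylindrical (R : realType) (f : config -> R) : continuous f ->
  forall e, 0 < e -> exists N, forall w w', agree N w w' -> `|f w - f w'| <= e.
Proof.
move=> fc e e0; have /compact_near_coveringP cov := config_compact.
have := cov nat \oo (fun N w => forall w', agree N w w' -> `|f w - f w'| <= e) _.
case=> [w _|N _ NP]; last first.
  by exists N => w; apply: (NP N) => //=.
have e20 : 0 < e / 2 by rewrite divr_gt0.
have /nbhs_agree[N0 N0w] : nbhs w [set w' | `|f w - f w'| < e / 2].
  have /(_ w)/cvgrPdist_lt := fc; exact.
exists ([set w' | agree N0 w w'], [set N | (N0 <= N)%N]).
  split; [exact: agree_nbhs|by exists N0].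
move=> [w' N] /= [ww' N0N] w'' ww''.
have h1 : `|f w - f w'| < e / 2 := N0w _ ww'.
have h2 : `|f w - f w''| < e / 2 := N0w _ (agree_trans ww' (agree_leq N0N ww'')).
have -> : f w' - f w'' = (f w - f w'') - (f w - f w') by ring.
apply: ltW; apply: le_lt_trans (ler_normB _ _) _; lra.
Qed.

Lemma cylindrical_continuous N (T : topologicalType) (f : config -> T) :
  cylindrical N f -> continuous f.
Proof.
move=> fN w U /nbhs_singleton Ufw.
by apply: filterS (agree_nbhs N w) => w' /= /fN <-.
Qed.

(** * Cylinders, and extension of contents to Borel probabilities *)

Definition cylinder (A : set config) := exists N, cylindrical N A.

Lemma cylinderP (A : set config) N :
  (forall w w', agree N w w' -> A w -> A w') -> cylindrical N A.
Proof.
move=> AN w w' ww'; apply/propext; split; first exact: AN.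
by apply: AN; apply: agreeC.
Qed.

Lemma cylinder_open A : cylinder A -> open A.
Proof.
move=> [N AN]; rewrite openE => w Aw; apply: filterS (agree_nbhs N w) => w' /= /AN <-.
exact: Aw.
Qed.

Lemma cylinder0 : cylinder set0.
Proof. by exists 0%N. Qed.

Lemma cylinderT : cylinder setT.
Proof. by exists 0%N. Qed.

Lemma cylinderU : setU_closed cylinder.
Proof.
move=> A B [M AM] [N BN]; exists (maxn M N) => w w' ww'.
by rewrite /setU /mkset (AM w w') ?(BN w w') //; apply: agree_leq ww'; rewrite ?leq_maxl ?leq_maxr.
Qed.

Lemma cylinderC : setC_closed cylinder.
Proof. by move=> A [N AN]; exists N => w w' ww'; rewrite /setC /mkset (AN w w'). Qed.

(** A copy of [config] that carries the algebra of cylinders, next to [config_borel] with its Borel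
    sigma-algebra. *)
Definition cylinder_config : Type := config.
HB.instance Definition _ := Pointed.on cylinder_config.

Fact cylinder_display : measure_display.
Proof. exact. Qed.

HB.instance Definition _ := @isAlgebraOfSets.Build cylinder_display cylinder_config
  cylinder cylinder0 cylinderU cylinderC.

(** An open set is the countable union over [N] of the largest cylinder of level [N] that it
    contains. *)
Lemma open_cylinder_sigma (U : set config) : open U -> <<s cylinder >> U.
Proof.
move=> oU; have -> : U = \bigcup_N [set w | [set w' | agree N w w'] `<=` U].
  apply/seteqP; split=> [w Uw|w [N _ NU]]; last exact: NU.
  have /nbhs_agree[N NU] : nbhs w U by apply: open_nbhs_nbhs.
  by exists N.
apply: sigma_algebra_bigcup => N; apply: sub_sigma_algebra; exists N.
apply: cylinderP => w w' ww' wU w'' w'w''; apply: wU.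
exact: agree_trans ww' w'w''.
Qed.

Lemma borel_cylinder_sigma (A : set config_borel) : measurable A ->
  <<s cylinder >> (A : set config).
Proof.
apply: (@smallest_sub _ (sigma_algebra setT) open <<s cylinder >>).
  exact: smallest_sigma_algebra.
exact: open_cylinder_sigma.
Qed.

Section CylinderMeasure.
Variables (R : realType) (m : set config -> R).
Hypotheses (m_ge0 : forall A, 0 <= m A)
  (m_add : forall A B, cylinder A -> cylinder B -> A `&` B = set0 -> m (A `|` B) = m A + m B)
  (mT : m setT = 1).

Let m0 : m set0 = 0.
Proof.
have := @m_add set0 set0 cylinder0 cylinder0; rewrite setU0 => /(_ (setI0 _)).
lra.
Qed.

Definition cylinder_content (A : set cylinder_config) : \bar R := (m A)%:E.

Let content0 : cylinder_content set0 = 0%E.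
Proof. by rewrite /cylinder_content m0. Qed.

Let content_ge0 A : (0 <= cylinder_content A)%E.
Proof. by rewrite lee_fin. Qed.

(** Cylinders are open and closed in a compact space, so a cylinder that is a countable union of
    cylinders is already a finite one. Countable additivity thus reduces to finite additivity. *)
Let content_sigma_additive : semi_sigma_additive cylinder_content.
Proof.
move=> F mF tF mUF.
have [n0 n0F] : exists n0, \bigcup_n F n `<=` \big[setU/set0]_(i < n0) F i.
  have /compact_near_coveringP cov := config_compact.
  pose P (n : nat) (w : config) := (\bigcup_n F n) w -> (\big[setU/set0]_(i < n) F i) w.
  have := cov nat \oo P _; case => [w _|N _ NP]; last first.
    by exists N => w Fw; apply: (NP N) => //=.
  have [[k _ Fkw]|nFw] := pselect ((\bigcup_n F n) w); last first.
    have [N FN] := mUF.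
    exists ([set w' | agree N w w'], setT); first by split; [exact: agree_nbhs|exact: filterT].
    move=> [w' n] /= [ww' _]; rewrite /P -(FN _ _ ww') => /nFw //.
  have [N FN] := mF k.
  exists ([set w' | agree N w w'], [set n | (k < n)%N]).
    by split; [exact: agree_nbhs|exists k.+1].
  move=> [w' n] /= [ww' kn] _; rewrite -bigcup_mkord; exists k => //=.
  by rewrite -(FN _ _ ww').
have Fcyl n : cylinder (\big[setU/set0]_(i < n) F i).
  by apply: big_ind; [exact: cylinder0|exact: cylinderU|move=> i _; exact: mF].
have Fsum n : \sum_(0 <= i < n) cylinder_content (F i) =
    cylinder_content (\big[setU/set0]_(i < n) F i).
  elim: n => [|n IH]; first by rewrite big_geq // big_ord0 content0.
  rewrite big_nat_recr //= IH big_ord_recr /= /cylinder_content m_add //; [exact: Fcyl|exact: mF|].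
  rewrite -bigcup_mkord; apply/seteqP; split=> // w [[i /= ik Fiw] Fkw].
  have : (F i `&` F n) w by split.
  by rewrite (trivIsetP.1 tF i n I I) // ltn_eqF.
apply: cvg_near_cst; exists n0 => // n /= n0n; rewrite Fsum; congr cylinder_content.
apply/seteqP; split; first by rewrite -bigcup_mkord; apply: bigcup_sub => i _; apply: bigcup_sup.
apply: subset_trans n0F _; rewrite -!bigcup_mkord; apply: bigcup_subset => i /=.
by move=> /leq_trans; apply.
Qed.

HB.instance Definition _ := isMeasure.Build _ _ _ cylinder_content
  content0 content_ge0 content_sigma_additive.

Definition cylinder_measure (A : set config_borel) : \bar R :=
  measure_extension cylinder_content A.

Let measure0' : cylinder_measure set0 = 0%E.
Proof. exact: measure0. Qed.

Let measure_ge0' A : (0 <= cylinder_measure A)%E.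
Proof. exact: measure_ge0. Qed.

Let measure_sigma_additive' : semi_sigma_additive cylinder_measure.
Proof.
move=> F mF tF mUF.
apply: (@measure_semi_sigma_additive _ _ _ (measure_extension cylinder_content)) => //.
  by move=> i; apply: borel_cylinder_sigma.
exact: borel_cylinder_sigma.
Qed.

HB.instance Definition _ := isMeasure.Build _ _ _ cylinder_measure
  measure0' measure_ge0' measure_sigma_additive'.

Lemma cylinder_measureE A : cylinder A -> cylinder_measure A = (m A)%:E.
Proof. by move=> cA; exact: (measurable_mu_extE cylinder_content cA). Qed.

Let measureT : cylinder_measure setT = 1%E.
Proof. by rewrite cylinder_measureE ?mT //; exact: cylinderT. Qed.

HB.instance Definition _ := Measure_isProbability.Build _ _ _ cylinder_measure measureT.

Definition cylinder_probability : probability config_borel R := cylinder_measure.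

End CylinderMeasure.

(** * Normalised positive functionals on continuous functions *)

Section Mean.
Variable R : realType.
Implicit Types (f g : config -> R) (phi : (config -> R) -> R).

(** Shared by finite-volume expectations and by integrals against a probability, so that weak
    convergence can be studied without turning the finite-volume models into Borel measures. *)
Definition mean phi :=
  [/\ forall f g, continuous f -> continuous g -> phi (fun w => f w + g w) = phi f + phi g,
      forall c f, continuous f -> phi (fun w => c * f w) = c * phi f,
      forall f g, continuous f -> continuous g -> (forall w, f w <= g w) -> phi f <= phi g
    & phi (fun=> 1) = 1].

Lemma mean_cst phi c : mean phi -> phi (fun=> c) = c.
Proof.
move=> [_ phiZ _ phi1]; transitivity (c * phi (fun=> 1)); last by rewrite phi1 mulr1.
rewrite -phiZ; last by move=> w; apply: cvg_cst.
by congr phi; apply/funext => w; rewrite mulr1.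
Qed.

Lemma mean_close phi f g e : mean phi -> continuous f -> continuous g ->
  (forall w, `|f w - g w| <= e) -> `|phi f - phi g| <= e.
Proof.
move=> mphi fc gc fg; have [phiD _ phile _] := mphi.
have le f1 f2 : continuous f1 -> continuous f2 -> (forall w, f1 w <= f2 w + e) ->
    phi f1 <= phi f2 + e.
  move=> c1 c2 f12; rewrite -[X in _ + X](mean_cst e mphi) -phiD //; last first.
    by move=> w; apply: cvg_cst.
  by apply: phile => // w; apply: cvgD; [exact: c2|exact: cvg_cst].
have h1 : phi f <= phi g + e by apply: le => // w; have := fg w; rewrite ler_norml; lra.
have h2 : phi g <= phi f + e by apply: le => // w; have := fg w; rewrite ler_norml; lra.
rewrite ler_norml; lra.
Qed.

Lemma mean_sum phi (I : Type) (s : seq I) (F : I -> config -> R) : mean phi ->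
  (forall i, continuous (F i)) ->
  phi (fun w => \sum_(i <- s) F i w) = \sum_(i <- s) phi (F i).
Proof.
move=> mphi Fc; have [phiD _ _ _] := mphi.
have sumc t : continuous (fun w => \sum_(i <- t) F i w).
  elim: t => [|i t IH] w.
    by under eq_fun do rewrite big_nil; exact: cvg_cst.
  by under eq_fun do rewrite big_cons; apply: cvgD; [exact: Fc|exact: IH].
elim: s => [|i s IH].
  by under [X in phi X]eq_fun do rewrite big_nil; rewrite big_nil mean_cst.
by under [X in phi X]eq_fun do rewrite big_cons; rewrite big_cons phiD // IH.
Qed.

Definition pattern (N : nat) (A : {set edges (box N)}) : set config :=
  [set w | forall e : edges (box N), w (val e) = (e \in A)].

Lemma pattern_cylindrical N (A : {set edges (box N)}) : cylindrical N (pattern A).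
Proof.
apply: cylinderP => w w' ww' wA e; rewrite -wA.
by apply/esym/ww'; exact: (valP e).
Qed.

Lemma indic_continuous (A : set config) : cylinder A -> continuous (\1_A : config -> R).
Proof.
move=> [N AN]; apply: (@cylindrical_continuous N) => w w' ww'.
have AE : A w = A w' := AN w w' ww'.
rewrite !indicE; suff -> : (w \in A) = (w' \in A) by [].
by apply/idP/idP => /set_mem h; apply/mem_set; [rewrite -AE|rewrite AE].
Qed.

Lemma cylindrical_sum N g : cylindrical N g ->
  g = (fun w => \sum_(A : {set edges (box N)}) g (config_of A) * \1_(pattern A) w).
Proof.
move=> gN; apply/funext => w; pose A := [set e : edges (box N) | w (val e)]%SET.
rewrite (bigD1 A) //= big1 ?addr0 => [|B BA].
  rewrite indicE mem_set ?mulr1; last by move=> e /=; rewrite inE.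
  apply: gN => e eN; rewrite -[e in RHS]/(val (FSetSub eN)) config_of_val inE.
  by [].
rewrite indicE memNset ?mulr0 // => wB; case/eqP: BA; apply/setP => e.
by rewrite inE wB.
Qed.

Lemma mean_cylindrical phi N g : mean phi -> cylindrical N g ->
  phi g = \sum_(A : {set edges (box N)}) g (config_of A) * phi (\1_(pattern A)).
Proof.
move=> mphi gN; rewrite {1}(cylindrical_sum gN); have [_ phiZ _ _] := mphi.
have ic (A : {set edges (box N)}) : continuous (\1_(pattern A) : config -> R).
  by apply: indic_continuous; exists N; exact: pattern_cylindrical.
rewrite mean_sum //; first by apply: eq_bigr => A _; rewrite phiZ.
by move=> A w; apply: cvgM; [exact: cvg_cst|exact: ic].
Qed.

Definition truncate (N : nat) (w : config) : config :=
  fun e => if e \in edges (box N) then w e else false.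

Lemma agree_truncate N w : agree N (truncate N w) w.
Proof. by move=> e eN; rewrite /truncate eN. Qed.

(** A continuous function is uniformly close to a cylindrical one, which is a finite combination of
    indicators of cylinders. *)
Lemma mean_cvg (E : nat -> (config -> R) -> R) phi : (forall n, mean (E n)) -> mean phi ->
  (forall A, cylinder A -> E n (\1_A) @[n --> \oo] --> phi (\1_A)) ->
  forall f, continuous f -> E n f @[n --> \oo] --> phi f.
Proof.
move=> mE mphi cE f fc; apply/cvgrPdist_le => e e0.
have e30 : 0 < e / 3 by rewrite divr_gt0.
have [N fN] := continuous_cylindrical fc e30.
pose g w := f (truncate N w).
have gN : cylindrical N g.
  move=> w w' ww'; congr f; apply/funext => i; rewrite /truncate.
  by case: ifP => // iN; rewrite ww'.
have gc : continuous g := cylindrical_continuous gN.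
have fg w : `|f w - g w| <= e / 3.
  by rewrite distrC; apply: fN; exact: agree_truncate.
have Eg : E n g @[n --> \oo] --> phi g.
  rewrite (mean_cylindrical mphi gN).
  under eq_fun do rewrite (mean_cylindrical (mE _) gN).
  apply: cvg_big => [|A _]; first exact: add_continuous.
  apply: cvgM; first exact: cvg_cst.
  by apply: cE; exists N; exact: pattern_cylindrical.
move/cvgrPdist_le: Eg => /(_ _ e30); apply: filterS => n Egn.
have := mean_close (mE n) fc gc fg; have := mean_close mphi fc gc fg.
move: Egn; rewrite !ler_norml; lra.
Qed.

End Mean.

Section ContinuousIntegral.
Variables (R : realType) (P : probability config_borel R).

Lemma continuous_measurable (f : config -> R) : continuous f ->
  measurable_fun [set: config_borel] (f : config_borel -> R).
Proof.
move=> /continuousP fc; apply: (measurability _ (measurable_realfun.RGenOpens.measurableE R)).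
move=> _ [_ [a [b ->] <-]]; rewrite setTI.
by apply: sub_sigma_algebra; apply: fc; exact: interval_open.
Qed.

Lemma continuous_integrable (f : config -> R) : continuous f ->
  P.-integrable [set: config_borel] (EFin \o f).
Proof.
move=> fc; apply: measurable_bounded_integrable;
  [exact: measurableT| |exact: continuous_measurable|].
  by apply: (@le_lt_trans _ _ 1%E); [exact: probability_le1|exact: ltry].
have [N fN] := continuous_cylindrical fc ltr01.
(* Every value of [f] is within 1 of its value at one of finitely many configurations, so the sum of
   their absolute values bounds [f] up to 1. *)
pose B := \sum_(A : {set edges (box N)}) `|f (config_of A)|.
exists (1 + B); split; first exact: num_real.
move=> M BM w _ /=; apply: le_trans (ltW BM).
pose A := [set e : edges (box N) | w (val e)]%SET.
have wA : agree N w (config_of A).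
  by move=> e eN; rewrite -[e in RHS]/(val (FSetSub eN)) config_of_val inE.
have -> : f w = (f w - f (config_of A)) + f (config_of A) by rewrite subrK.
apply: le_trans (ler_normD _ _) _; apply: lerD; first exact: fN.
by rewrite /B (bigD1 A) //= lerDl sumr_ge0.
Qed.

Lemma expectation_mean : mean (fun f : config -> R => fine 'E_P[f]).
Proof.
split=> [f g fc gc|c f fc|f g fc gc fg|]; last exact: (congr1 fine (expectation_cst P 1)).
- by rewrite unlock; apply: (RintegralD measurableT); exact: continuous_integrable.
- by rewrite unlock; apply: (RintegralZl c measurableT); exact: continuous_integrable.
- by rewrite unlock; apply: (le_Rintegral measurableT) => //; exact: continuous_integrable.
Qed.

Lemma expectation_fine (f : config -> R) : continuous f -> ('E_P[f] = (fine 'E_P[f])%:E)%E.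
Proof.
move=> fc; rewrite fineK // unlock; apply: integrable_fin_num => //.
exact: continuous_integrable.
Qed.

Lemma cylinder_measurable (A : set config) : cylinder A -> measurable (A : set config_borel).
Proof. by move=> cA; apply: sub_sigma_algebra; exact: cylinder_open. Qed.

Lemma expectation_cylinder (A : set config) : cylinder A -> ('E_P[\1_A] = P A)%E.
Proof.
by move=> cA; rewrite unlock integral_indic ?setIT //; exact: cylinder_measurable.
Qed.

End ContinuousIntegral.

(** * The wired infinite-volume measure *)

Section WiredLimit.
Variables (R : realType) (p q : R).
Hypotheses (p01 : 0 <= p <= 1) (q_ge1 : 1 <= q).

Lemma rc_expectation_mean (G : subgraph) (xi : {set {set sites G}}) :
  mean (rc_expectation p q xi).
Proof.
split=> [f g _ _|c f _|f g _ _ fg|]; rewrite !rc_expectationE.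
- exact: expectD.
- exact: expectZ.
- by apply: ler_expect => //; [move=> A; exact: cweight_gt0].
- by apply: expect_cst => // A; exact: cweight_gt0.
Qed.

Definition wired_expectation (N : nat) (f : config -> R) : R :=
  rc_expectation p q (wired_box N) f.

Lemma wired_expectation_mean N : mean (wired_expectation N).
Proof. exact: rc_expectation_mean. Qed.

Lemma rc_expectation_le_box (K : nat) (G : subgraph) (xi : {set {set sites G}}) (y : site)
    (f : config -> R) : induced G ->
  (forall B, B \in xi -> (B \subset boundary G)%SET) ->
  (forall x, (nrm x <= K)%N -> shift y x \in sites G) ->
  (forall w w', config_le w w' -> f w <= f w') -> cylindrical K f ->
  rc_expectation p q xi (fun w => f (w \o shift_edge y)) <= wired_expectation K f.
Proof.
move=> Gi xib KG finc floc.
apply: (@rc_expectation_le R p q (box K) G y xi p01 q_ge1 (@box_induced K) Gi xib _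
  (box_corner K) (box_corner_boundary K) f) => //.
by move=> x; rewrite mem_box; exact: KG.
Qed.

Lemma wired_box_boundary N B : B \in wired_box N -> (B \subset boundary (box N))%SET.
Proof. by rewrite inE => /eqP->. Qed.

Lemma shift_edge0 (w : config) : w \o shift_edge origin = w.
Proof.
by apply/funext => -[[a b] c]; rewrite /= /shift_edge /shift /= !addr0.
Qed.

Lemma wired_expectation_noninc K N (f : config -> R) :
  (forall w w', config_le w w' -> f w <= f w') -> cylindrical K f -> (K <= N)%N ->
  wired_expectation N.+1 f <= wired_expectation N f.
Proof.
move=> finc fK KN.
have -> : wired_expectation N.+1 f = wired_expectation N.+1 (fun w => f (w \o shift_edge origin)).
  by congr wired_expectation; apply/funext => w; rewrite shift_edge0.
apply: rc_expectation_le_box => //; [exact: box_induced|exact: wired_box_boundary| |].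
  by move=> [a b] xN; rewrite mem_box /shift /= !addr0 leqW.
exact: cylindrical_leq KN fK.
Qed.

Lemma wired_expectation_cvg_increasing K (f : config -> R) :
  (forall w w', config_le w w' -> f w <= f w') -> (forall w, 0 <= f w) -> cylindrical K f ->
  cvgn (wired_expectation ^~ f).
Proof.
move=> finc f0 fK.
suff : cvgn (fun n => wired_expectation (n + K) f).
  by move=> /cvg_ex[l ul]; apply/cvg_ex; exists l; rewrite -(cvg_shiftn K).
apply: nonincreasing_is_cvgn.
  apply/nonincreasing_seqP => n /=; rewrite addSn.
  by apply: (wired_expectation_noninc finc fK); rewrite leq_addl.
exists 0 => _ [n _ <-]; rewrite -(mean_cst 0 (wired_expectation_mean (n + K))).
have [_ _ le _] := wired_expectation_mean (n + K).
apply: le => //; first by move=> w; exact: cvg_cst.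
exact: cylindrical_continuous fK.
Qed.

Definition all_open (T : seq edge) (w : config) : R := (all w T)%:R.

Definition overwrite (e : edge) (b : bool) (w : config) : config :=
  fun e' => if e' == e then b else w e'.

(* Every cylinder function is a linear combination of the increasing functions
   [all_open T], whose wired expectations decrease with the box. *)
Lemma wired_expectation_cvg K (f : config -> R) : cylindrical K f ->
  cvgn (wired_expectation ^~ f).
Proof.
move=> fK; have [s sK] : {s : seq edge | s =i edges (box K)} by exists (edges (box K)).
have {}fK : forall w w', (forall e, e \in s -> w e = w' e) -> f w = f w'.
  by move=> w w' ww'; apply: fK => e; rewrite -sK => /ww'.
have {}sK : forall e, e \in s -> e \in edges (box K) by move=> e; rewrite sK.
(* [T] collects the edges already required to be open, while the induction shortens the list of
   edges on which [f] depends. *)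
suff main (T : seq edge) : (forall e, e \in T -> e \in edges (box K)) ->
    cvgn (wired_expectation ^~ (fun w => all_open T w * f w)).
  have := main [::] (fun _ => ltac:(by [])).
  under [X in cvgn X]eq_fun do under [X in wired_expectation _ X]eq_fun do
    rewrite /all_open /= mul1r.
  by [].
elim: s f fK sK T => [|e s IH] f fs sK T TK.
  have fc w : f w = f (fun=> false) by apply: fs.
  under eq_fun do under [X in wired_expectation _ X]eq_fun do rewrite mulrC fc.
  have Tcyl : cylindrical K (all_open T).
    by move=> w w' ww'; congr (_%:R); rewrite /all_open (eq_in_all (a2 := w')) // => e /TK/ww'.
  have eZ n : wired_expectation n (fun w => f (fun=> false) * all_open T w) =
      f (fun=> false) * wired_expectation n (all_open T).
    have [_ wZ _ _] := wired_expectation_mean n; apply: wZ.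
    exact: cylindrical_continuous Tcyl.
  under eq_fun do rewrite eZ.
  apply: is_cvgM; first exact: is_cvg_cst.
  apply: wired_expectation_cvg_increasing Tcyl => [w w' ww'|w]; last exact: ler0n.
  rewrite ler_nat /all_open; case: (boolP (all w T)) => // /allP aT.
  by rewrite (_ : all w' T) //; apply/allP => i /aT/ww'.
pose f0 w := f (overwrite e false w); pose f1 w := f (overwrite e true w).
have fx b w w' : (forall i, i \in s -> w i = w' i) -> f (overwrite e b w) = f (overwrite e b w').
  move=> ww'; apply: fs => i; rewrite inE /overwrite; case: eqP => //= _; exact: ww'.
have decomp w : all_open T w * f w = all_open T w * f0 w + all_open (e :: T) w * (f1 w - f0 w).
  have -> : f w = if w e then f1 w else f0 w.
    by rewrite /f0 /f1; case we: (w e); apply: fs => i _; rewrite /overwrite; case: eqP => // ->.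
  rewrite /all_open /=; case: (w e) => /=; last by rewrite mul0r addr0.
  by rewrite -mulrDr addrC subrK.
under eq_fun do under [X in wired_expectation _ X]eq_fun do rewrite decomp.
have eK : e \in edges (box K) by apply: sK; rewrite mem_head.
have sK' i : i \in s -> i \in edges (box K) by move=> si; apply: sK; rewrite inE si orbT.
have cyl T' h : (forall i, i \in T' -> i \in edges (box K)) ->
    (forall w w', (forall i, i \in s -> w i = w' i) -> h w = h w') ->
    continuous (fun w => all_open T' w * h w).
  move=> T'K hs; apply: (@cylindrical_continuous K) => w w' ww'; congr (_ * _).
    by congr (_%:R); rewrite /all_open (eq_in_all (a2 := w')) // => i /T'K/ww'.
  by apply: hs => i /sK'/ww'.
have eTK i : i \in e :: T -> i \in edges (box K).
  by rewrite inE => /predU1P[->//|/TK].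
have f10s w w' : (forall i, i \in s -> w i = w' i) -> f1 w - f0 w = f1 w' - f0 w'.
  by move=> ww'; rewrite /f1 /f0 (fx true _ _ ww') (fx false _ _ ww').
have eD n : wired_expectation n
      (fun w => all_open T w * f0 w + all_open (e :: T) w * (f1 w - f0 w)) =
    wired_expectation n (fun w => all_open T w * f0 w) +
    wired_expectation n (fun w => all_open (e :: T) w * (f1 w - f0 w)).
  have [wD _ _ _] := wired_expectation_mean n.
  by apply: wD; apply: cyl => //; apply: fx.
under eq_fun do rewrite eD.
by apply: is_cvgD; apply: IH => //; apply: fx.
Qed.

(** The absolute value only makes the set function nonnegative on sets that are not cylinders, where
    no convergence is known; on cylinders it changes nothing. *)
Let limit_mass (A : set config) : R := `|limn (wired_expectation ^~ (\1_A : config -> R))|.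

Let indic_cvg (A : set config) : cylinder A ->
  wired_expectation n (\1_A : config -> R) @[n --> \oo] --> limit_mass A.
Proof.
move=> cA; have cv : cvgn (wired_expectation ^~ (\1_A : config -> R)).
  have [N AN] := cA; apply: (@wired_expectation_cvg N) => w w' ww'.
  have AE : A w = A w' := AN w w' ww'.
  rewrite !indicE; suff -> : (w \in A) = (w' \in A) by [].
  by apply/idP/idP => /set_mem h; apply/mem_set; [rewrite -AE|rewrite AE].
rewrite /limit_mass ger0_norm //; apply: limr_ge => //; apply: nearW => n.
have [_ _ le _] := wired_expectation_mean n.
rewrite -(mean_cst 0 (wired_expectation_mean n)).
apply: le => //; first by move=> w; exact: cvg_cst.
exact: indic_continuous.
Qed.

Let limit_mass_ge0 A : 0 <= limit_mass A.
Proof. exact: normr_ge0. Qed.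

Let limit_mass_add A B : cylinder A -> cylinder B -> A `&` B = set0 ->
  limit_mass (A `|` B) = limit_mass A + limit_mass B.
Proof.
move=> cA cB AB; have cvAB := indic_cvg (cylinderU cA cB).
have eD n : wired_expectation n (\1_(A `|` B)) =
    wired_expectation n (\1_A) + wired_expectation n (\1_B).
  have [wD _ _ _] := wired_expectation_mean n.
  rewrite -wD; [|exact: indic_continuous|exact: indic_continuous].
  congr wired_expectation; apply/funext => w; rewrite !indicE in_setU.
  case: (boolP (w \in A)) => [/set_mem Aw|_] /=; last by rewrite add0r.
  rewrite memNset ?addr0 // => Bw.
  by have : (A `&` B) w by []; rewrite AB.
have cv2 : wired_expectation n \1_(A `|` B) @[n --> \oo] --> limit_mass A + limit_mass B.
  by under eq_fun do rewrite eD; apply: cvgD; exact: indic_cvg.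
by rewrite -(cvg_lim (@Rhausdorff R) cvAB) (cvg_lim (@Rhausdorff R) cv2).
Qed.

Let limit_massT : limit_mass setT = 1.
Proof.
have e1 n : wired_expectation n (\1_setT) = 1.
  have [_ _ _ <-] := wired_expectation_mean n.
  by congr wired_expectation; apply/funext => w; rewrite indicT.
have cv2 : wired_expectation n \1_setT @[n --> \oo] --> (1 : R).
  by under eq_fun do rewrite e1; exact: cvg_cst.
by rewrite -(cvg_lim (@Rhausdorff R) (indic_cvg cylinderT)) (cvg_lim (@Rhausdorff R) cv2).
Qed.

Lemma wired_infinite_volume : exists2 phi : probability config_borel R,
  infinite_volume p q phi &
  forall f : config -> R, continuous f -> wired_expectation n f @[n --> \oo] --> fine 'E_phi[f].
Proof.
pose phi := cylinder_probability limit_mass_ge0 limit_mass_add limit_massT.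
have phiE A : cylinder A -> phi A = (limit_mass A)%:E by move=> cA; exact: cylinder_measureE.
have cv (f : config -> R) : continuous f -> wired_expectation n f @[n --> \oo] --> fine 'E_phi[f].
  move=> fc; apply: (@mean_cvg R wired_expectation (fun f => fine 'E_phi[f])
    wired_expectation_mean (expectation_mean phi) _ f fc).
  move=> A cA; rewrite expectation_cylinder // phiE //; exact: indic_cvg.
exists phi => //; exists box, wired_box; split; first exact: boxes_exhaust.
  (* A partition has no empty block, hence the need for a boundary site. *)
  move=> n; rewrite /finset.partition finset.cover1 eqxx finset.trivIset1 /= inE.
  apply/negP => /eqP b0; have := box_corner_boundary n.
  by rewrite -b0 inE.
move=> f fc; rewrite expectation_fine //; apply: cvg_EFin; last exact: cv.
by apply: nearW.
Qed.

End WiredLimit.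

(** * From wired boxes to infinite-volume measures *)

Lemma exits_cylinder r : cylinder (exits r).
Proof.
exists r.+1; apply: cylinderP => w w' ww'; apply: exits_local (ltnSn r) _ => //.
Qed.

Lemma exits_infinite_cluster w : (forall r, exits r w) -> has_infinite_cluster w.
Proof.
move=> ew; exists origin => /finite_fsetP[X XE].
have [z [zw]] := ew (\max_(y <- X) nrm y).
have zX : z \in X by have : [set` X] z by rewrite -XE.
by rewrite ltnNge leq_bigmax_seq.
Qed.

Section Decay.
Variables (R : realType) (p q : R).
Hypotheses (p01 : 0 <= p <= 1) (q_ge1 : 1 <= q).

(** The events [exits r] decrease, and on their intersection the origin has an infinite cluster, so
    their probabilities tend to 0 under the wired limit. For a fixed [r], a cylinder event, weak
    convergence returns to a finite box. *)
Lemma exit_prob_small : (forall phi : probability config_borel R, infinite_volume p q phi ->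
    {ae phi, forall w, ~ has_infinite_cluster w}) ->
  forall d, 0 < d -> exists r N, (r < N)%N /\ exit_prob q p N r <= d.
Proof.
move=> nocl d d0; have [phi ivphi cvphi] := wired_infinite_volume p01 q_ge1.
have [B [mB phiB sB]] := nocl phi ivphi.
have mex r : measurable (exits r : set config_borel).
  exact: (cylinder_measurable (exits_cylinder r)).
have cv : phi (exits r) @[r --> \oo] --> 0%E.
  have mcap : measurable (\bigcap_r exits r : set config_borel) by exact: bigcapT_measurable.
  have phicap : phi (\bigcap_r exits r) = 0%E.
    apply/eqP; rewrite eq_le measure_ge0 andbT -phiB; apply: le_measure; rewrite ?inE //.
    move=> w ew; apply: sB => /= nw; apply: nw.
    by apply: exits_infinite_cluster => r; exact: ew.
  rewrite -phicap; apply: nonincreasing_cvg_mu => //.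
    by apply: (@le_lt_trans _ _ 1%E); [exact: probability_le1|exact: ltry].
  move=> m n mn; apply/subsetPset => w [z [zw nz]]; exists z; split=> //.
  exact: leq_ltn_trans mn nz.
have [r phir] : exists r, (phi (exits r) < d%:E)%E.
  apply: contrapT => /forallNP big.
  suff : (d%:E <= 0)%E by rewrite lee_fin leNgt d0.
  by apply: (cvge_ge _ cv); apply: nearW => r; rewrite leNgt; apply/negP/big.
have cr := cvphi _ (@indic_continuous R _ (exits_cylinder r)).
have : \forall n \near \oo, wired_expectation p q n (\1_(exits r)) < d.
  apply: (cvgr_lt _ cr); rewrite expectation_cylinder; last exact: exits_cylinder.
  by rewrite -lte_fin fineK // fin_num_measure.
move=> [N0 _ N0d]; exists r, (maxn N0 r.+1); split; first by rewrite leq_maxr.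
have := N0d (maxn N0 r.+1) (leq_maxl _ _); by move=> /ltW; congr (rc_expectation _ _ _ _ <= _).
Qed.

Lemma joined_open x y : open [set w | joined w x y].
Proof.
rewrite openE => w [s [sp <-]]; suff : nbhs w [set w' | joined w' x (last x s)] by [].
elim: s x sp => [|z s IH] x /=.
  move=> _; apply: filterS (agree_nbhs 0 w) => w' _; exact: joined_refl.
move=> /andP[xz zs].
apply: filterS (filterI (IH z zs) (agree_nbhs (nrm x).+1 w)) => w' [zw' ww'] /=.
exact: joined_cons (open_adj_local ww' (ltnSn _) xz) zw'.
Qed.

Lemma joined_measurable x y : measurable ([set w | joined w x y] : set config_borel).
Proof. by apply: sub_sigma_algebra; exact: joined_open. Qed.

(** The connection event need not be a cylinder, so weak convergence is applied to an exit event
    that contains it. In finite volume that event is bounded through the wired box of radius [M]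
    around [x]. *)
Lemma infinite_volume_exits (phi : probability config_borel R) r M x y :
  infinite_volume p q phi -> (r < M)%N -> (r < dist y x)%N ->
  (phi [set w | joined w x y] <= (exit_prob q p M r)%:E)%E.
Proof.
move=> [G [xi [[boxG incG exG] partG cvG]]] rM rd.
pose A := [set w : config | exits r (w \o shift_edge x)].
have cA : cylinder A.
  exists (nrm x + r.+1)%N; apply: cylinderP => w w' ww'.
  apply: exits_local (ltnSn r) _ => e er /=; apply: ww'.
  move: er; rewrite !box_induced !mem_box shift_head => /andP[e1 e2].
  by apply/andP; split; rewrite ?/shift_edge /=; apply: leq_trans (nrm_shift _ _) _;
    rewrite leq_add2l.
have Ac := @indic_continuous R _ cA.
apply: (@le_trans _ _ (phi A)).
  apply: le_measure; rewrite ?inE; [exact: joined_measurable|exact: cylinder_measurable|].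
  by move=> w wxy; apply: exits_dist wxy rd.
have /cvG := Ac; rewrite expectation_cylinder // => cv.
have ind n : induced (G n) by have [a [b []]] := boxG n.
have incG' m n : (m <= n)%N -> forall z, z \in sites (G m) -> z \in sites (G n).
  move=> /subnK <-; elim: (n - m)%N => [//|k IH] z zm.
  by rewrite addSn; apply: (fsubsetP (incG _)); exact: IH.
have [n0 n0G] : exists n0, forall z, z \in enum_fset (box_sites M) -> shift x z \in sites (G n0).
  elim: (enum_fset _) => [|z s [n IH]]; first by exists 0%N.
  have [m zm] := exG (shift x z); exists (maxn m n) => z'.
  rewrite inE => /predU1P[->|/IH]; first exact: incG' (leq_maxl _ _) _ zm.
  exact: incG' (leq_maxr _ _) _.
apply: (cvge_le _ cv); exists n0 => // n /= n0n; rewrite lee_fin.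
have -> : (\1_A : config -> R) = (fun w => (w \o shift_edge x \in exits r)%:R).
  apply/funext => w; rewrite indicE; suff -> : (w \in A) = (w \o shift_edge x \in exits r) by [].
  by apply/idP/idP => /set_mem h; apply/mem_set.
apply: exit_prob_ge => //.
  move=> B Bxi; have /and3P[/eqP cov _ _] := partG n.
  by rewrite -cov; apply: finset.bigcup_sup.
move=> z zM; apply: incG' n0n _ _; apply: n0G.
by rewrite -[_ \in _]/(z \in box_sites M) mem_box_sites.
Qed.

End Decay.

Lemma euclid_dist_le (R : realType) (x y : site) : euclid_dist R x y <= 2 * (dist y x)%:R.
Proof.
have d0 : (0 : R) <= 2 * (dist y x)%:R by rewrite mulr_ge0.
rewrite /euclid_dist -[leRHS]ger0_norm // -sqrtr_sqr ler_wsqrtr //.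
have sq (a : int) : (`|a| <= dist y x)%N -> (a%:~R : R) ^+ 2 <= (dist y x)%:R ^+ 2.
  move=> ad; rewrite -real_normK ?num_real // lerXn2r ?nnegrE //.
  by rewrite -intr_norm -[leRHS]/((dist y x)%:~R) ler_int; lia.
have h1 : (`|x.1 - y.1| <= dist y x)%N by rewrite /dist /nrm /shift /=; lia.
have h2 : (`|x.2 - y.2| <= dist y x)%N by rewrite /dist /nrm /shift /=; lia.
have := sq _ h1; have := sq _ h2; have := sqr_ge0 ((dist y x)%:R : R).
rewrite exprMn; lra.
Qed.

Theorem theorem2 (R : realType) (q pc : R) (hq : 1 <= q)
    (hpc : is_critical_point q pc) (p : R) (hp0 : 0 <= p) (hp : p < pc) :
  exists C c : R, [/\ 0 < C, 0 < c &
    forall phi : probability config_borel R, infinite_volume p q phi ->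
    forall x y : site,
      (phi [set w | joined w x y]
         <= (C * expR (- c * euclid_dist R x y))%:E)%E].
Proof.
have [/andP[_ pc1] nocluster _] := hpc.
pose p2 := (p + pc) / 2.
have pp2 : 0 <= p < p2 by rewrite /p2; lra.
have p2pc : p2 < pc by rewrite /p2; lra.
have p2_01 : 0 <= p2 <= 1 by lra.
have p01 : 0 <= p <= 1 by lra.
have [c [/andP[c0 c1] cM]] := exit_prob_decay hq pp2 (lt_le_trans p2pc pc1)
  (exit_prob_small p2_01 hq (fun phi iv => nocluster p2 phi p2_01 iv p2pc)).
have lnc : ln c < 0 by rewrite ln_lt0 // c0.
(* The rate is halved because the Euclidean distance is bounded by twice the sup-distance. *)
exists (2 / c), (- ln c / 2); split; [by rewrite divr_gt0|by rewrite divr_gt0 // oppr_gt0|].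
move=> phi iv x y.
have bound : 2 / c * c ^+ dist y x <= 2 / c * expR (- (- ln c / 2) * euclid_dist R x y).
  have -> : c ^+ dist y x = expR ((dist y x)%:R * ln c) by rewrite expRM_natl lnK ?posrE.
  apply: ler_wpM2l; first by rewrite divr_ge0 // ltW.
  have lnc2 : 0 <= - ln c / 2 by rewrite divr_ge0 // oppr_ge0 ltW.
  rewrite ler_expR; have := ler_wpM2l lnc2 (euclid_dist_le R x y); lra.
apply: le_trans (_ : ((2 / c * c ^+ dist y x)%:E <= _)%E); last by rewrite lee_fin.
case: (posnP (dist y x)) => [->|d0].
  apply: (@le_trans _ _ 1%E); first by apply: probability_le1; exact: joined_measurable.
  by rewrite expr0 mulr1 lee_fin ler_pdivlMr //; lra.
(* [exits r] asks for a distance strictly above [r], so the largest usable radius is [dist y x - 1];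
   the lost power of [c] explains the constant [2 / c]. *)
have [M [rM eM]] := cM (dist y x).-1.
apply: (le_trans (infinite_volume_exits p01 hq iv (leq_trans _ rM) _)).
- exact: leqnn.
- by rewrite prednK.
rewrite lee_fin; apply: le_trans eM _.
by rewrite -{2}(prednK d0) exprS mulrA divfK // gt_eqF.
Qed.
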